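(* Let $\mathcal{X}$ be a compact metrizable space, $T:\mathcal{X}\to\mathcal{X}$ a continuous map, and $d$ a metric on $\mathcal{X}$ compatible with the topology. Then $$\overline{\mathrm{mdim}}_M(T,\mathcal{X},d)=\limsup_{\epsilon\to 0}\frac{\sup_{\mu\in E(\mathcal{X},T)}R_{\mu,L^\infty}(\epsilon)}{\log\frac1\epsilon}$$ and $$\underline{\mathrm{mdim}}_M(T,\mathcal{X},d)=\liminf_{\epsilon\to 0}\frac{\sup_{\mu\in E(\mathcal{X},T)}R_{\mu,L^\infty}(\epsilon)}{\log\frac1\epsilon}.$$
   Context: $M(\mathcal{X},T)$ denotes the set of $T$-invariant Borel probability measures on $\mathcal{X}$ and $E(\mathcal{X},T)$ the set of ergodic ones. Logarithms are natural. Metric mean dimension. For $n\in\mathbb{N}$ let $d_n(x,y)=\max_{0\le j\le n-1}d(T^jx,T^jy)$. For $\epsilon>0$ let $r_n(T,d,\epsilon,\mathcal{X})$ be the smallest cardinality of a set $E\subset\mathcal{X}$ such that for every $x\in\mathcal{X}$ there is $y\in E$ with $d_n(x,y)<\epsilon$. Put $r(T,\mathcal{X},d,\epsilon)=\limsup_{n\to\infty}\frac1n\log r_n(T,d,\epsilon,\mathcal{X})$. The upper and lower metric mean dimensions are $$\overline{\mathrm{mdim}}_M(T,\mathcal{X},d)=\limsup_{\epsilon\to0}\frac{r(T,\mathcal{X},d,\epsilon)}{\log\frac1\epsilon},\qquad \underline{\mathrm{mdim}}_M(T,\mathcal{X},d)=\liminf_{\epsilon\to0}\frac{r(T,\mathcal{X},d,\epsilon)}{\log\frac1\epsilon}.$$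 Mutual information. For random variables $\xi,\eta$ defined on a probability space $(\Omega,\mathbb{P})$ with values in measurable spaces $\mathcal{A}$, $\mathcal{Y}$, the mutual information $I(\xi;\eta)$ is the supremum, over all finite measurable partitions $\{P_1,\dots,P_M\}$ of $\mathcal{A}$ and $\{Q_1,\dots,Q_N\}$ of $\mathcal{Y}$, of $$\sum_{m,n}\mathbb{P}(\xi\in P_m,\eta\in Q_n)\log\frac{\mathbb{P}(\xi\in P_m,\eta\in Q_n)}{\mathbb{P}(\xi\in P_m)\mathbb{P}(\eta\in Q_n)},$$ with the convention $0\log\frac0a=0$ for all $a\ge0$. $L^\infty$-rate distortion function. For $\mu\in M(\mathcal{X},T)$, $\epsilon>0$ and $s>0$, $R_{\mu,L^\infty}(\epsilon,s)$ is the infimum of $\frac{I(\xi;\eta)}{n}$, where $n$ runs over all natural numbers and $\xi$, $\eta=(\eta_0,\dots,\eta_{n-1})$ are random variables defined on some probability space $(\Omega,\mathbb{P})$ such that: (1) $\xi$ takes values in $\mathcal{X}$ and has law $\mu$; (2) each $\eta_k$ takes values in $\mathcal{X}$ and $$\mathbb{E}\big(\#\{0\le k\le n-1: d(T^k\xi,\eta_k)\ge\epsilon\}\big)<sn.$$ Set $R_{\mu,L^\infty}(\epsilon)=\lim_{s\to0}R_{\mu,L^\infty}(\epsilon,s)$. *)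

(* Defs.v *)
From HB Require Import structures.
From mathcomp Require Import all_boot all_order all_algebra finmap.
From mathcomp Require Import all_classical all_reals all_analysis.

Set Implicit Arguments.
Unset Strict Implicit.
Unset Printing Implicit Defensive.

Import Order.TTheory GRing.Theory Num.Theory.
Import numFieldNormedType.Exports.

Local Open Scope classical_set_scope.
Local Open Scope ring_scope.

(* A metric space with a distinguished point.  The library's measurable types
   are pointed, so that the point is needed for the Borel sigma-algebra to be
   an instance of measurableType; it plays no other role. *)
#[short(type="pmetricType")]
HB.structure Definition PointedMetric (K : numDomainType) :=
  { M of Metric K M & Pointed M }.

Notation borel X := (g_sigma_algebraType (@open X)).

Section MetricMeanDimension.
Context {R : realType} {X : pmetricType R}.
Variable T : X -> X.

Definition bowen_dist (n : nat) (x y : X) : R :=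
  \big[Num.max/0]_(j < n) mdist (iter j T x) (iter j T y).

Definition spanning (n : nat) (eps : R) (E : {fset X}) : Prop :=
  forall x : X, exists2 y, y \in E & bowen_dist n x y < eps.

(* The infimum is +oo when no finite set is spanning; otherwise it is attained,
   as the infimum of a nonempty set of natural numbers. *)
Definition spanning_number (n : nat) (eps : R) : \bar R :=
  ereal_inf [set (#|` E|%:R)%:E | E in [set E | spanning n eps E]].

Definition spanning_rate (eps : R) : \bar R :=
  limn_esup (fun n => lne (spanning_number n eps) / (n%:R)%:E)%E.

Definition upper_mdim : \bar R :=
  limf_esup (fun eps : R => spanning_rate eps / (ln eps^-1)%:E)%E 0^'+.

Definition lower_mdim : \bar R :=
  limf_einf (fun eps : R => spanning_rate eps / (ln eps^-1)%:E)%E 0^'+.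

End MetricMeanDimension.

Section MutualInformation.
Context {R : realType} {d dA dY : measure_display} {Omega : measurableType d}
  {A : measurableType dA} {Y : measurableType dY}.
Variables (P : probability Omega R) (xi : {RV P >-> A}) (eta : {RV P >-> Y}).

Definition measurable_partition {d'} {B : measurableType d'} (m : nat)
    (F : 'I_m -> set B) : Prop :=
  (forall i, measurable (F i)) /\ partition [set: 'I_m] F [set: B].

(* A term with joint probability 0 is 0 * _ = 0.  When the joint probability is
   positive, so are both marginals. *)
Definition partition_information (m n : nat) (F : 'I_m -> set A)
    (G : 'I_n -> set Y) : R :=
  \sum_(i < m) \sum_(j < n)
    let pFG := fine (P (xi @^-1` F i `&` eta @^-1` G j)) in
    let pF := fine (P (xi @^-1` F i)) in
    let pG := fine (P (eta @^-1` G j)) in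
    pFG * ln (pFG / (pF * pG)).

Definition mutual_information : \bar R :=
  ereal_sup [set v | exists (m n : nat) (F : 'I_m -> set A) (G : 'I_n -> set Y),
    [/\ measurable_partition F, measurable_partition G &
        v = (partition_information F G)%:E]].

End MutualInformation.

Section RateDistortion.
Context {R : realType} {X : pmetricType R}.
Variable T : X -> X.

Definition invariant_measures : set (probability (borel X) R) :=
  [set mu | forall A : set (borel X), measurable A -> mu (T @^-1` A) = mu A].

Definition ergodic_measures : set (probability (borel X) R) :=
  [set mu | invariant_measures mu /\
    forall A : set (borel X), measurable A -> T @^-1` A = A ->
      mu A = 0%E \/ mu A = 1%E].

Definition distortion_count (eps : R) (n : nat) (x : X) (y : n.-tuple X) : nat :=
  #|[pred k : 'I_n | eps <= mdist (iter k T x) (tnth y k)]|.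

(* eta is a random vector for the product sigma-algebra on n.-tuple (borel X),
   i.e. each of its n coordinates is a random variable. *)
Definition distortion_admissible (mu : probability (borel X) R) (eps s : R)
    (n : nat) {d} {Omega : measurableType d} (P : probability Omega R)
    (xi : {RV P >-> borel X}) (eta : {RV P >-> n.-tuple (borel X)}) : Prop :=
  (forall A : set (borel X), measurable A -> distribution P xi A = mu A) /\
  ('E_P[fun w => (distortion_count eps (xi w) (eta w))%:R] < (s * n%:R)%:E)%E.

Definition rate_distortion_at (mu : probability (borel X) R) (eps s : R)
    : \bar R :=
  ereal_inf [set v | exists (n : nat) (d : measure_display)
      (Omega : measurableType d) (P : probability Omega R)
      (xi : {RV P >-> borel X}) (eta : {RV P >-> n.-tuple (borel X)}),
    [/\ (0 < n)%N, distortion_admissible mu eps s xi eta &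
        v = (mutual_information xi eta / (n%:R)%:E)%E]].

Definition rate_distortion (mu : probability (borel X) R) (eps : R) : \bar R :=
  lim (rate_distortion_at mu eps s @[s --> 0^'+]).

End RateDistortion.

(* Main.v *)
Require Import Defs.
From HB Require Import structures.
From mathcomp Require Import all_boot all_order all_algebra finmap.
From mathcomp Require Import all_classical all_reals all_analysis.
From mathcomp Require Import measurable_realfun.
From mathcomp Require Import ring lra.

Set Implicit Arguments.
Unset Strict Implicit.
Unset Printing Implicit Defensive.

Import Order.TTheory GRing.Theory Num.Theory.
Import numFieldNormedType.Exports.

Local Open Scope classical_set_scope.
Local Open Scope ring_scope.

(** For an invariant measure [mu], quantizing a point to a member of a spanning set
    is a code without distortion whose information is at most the logarithm of the
    size of the spanning set.  Hence [rate_distortion T mu eps] is at most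
    [spanning_rate T eps], which is [rate_distortion_le_spanning_rate].

    Conversely, [spanning_rate T (6 * eps)] is at most the supremum of
    [rate_distortion T mu eps] over the ergodic measures plus [ln 2]
    ([spanning_rate_le_rate_distortion]).  Dividing by [ln eps^-1] makes the factor
    [6] and the summand [ln 2] irrelevant ([limf_scale_le]).

    The converse rests on the Lagrangian dual of rate distortion.  Fix a kernel
    [kappa] with values between [expR (- lam)] and [1] that is [1] at small
    distances and [expR (- lam)] at large ones.  A codebook is a finitely supported
    probability on words, the likelihood of [x] is the mean over the words of the
    product of [kappa] along the orbit of [x], and the code length is minus its
    logarithm.  The mean code length is affine and continuous in the law of [x].
    Codebooks multiply under concatenation and may be mixed at the cost of [ln 2].
    Three facts combine.

    - If all codes of length [N] have mean length at least [h * N] under [mu], then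
      [h] is at most the rate distortion ([rate_distortion_ge]): the law of a
      finely quantized output is a codebook, and Gibbs' inequality bounds the
      information from below by its mean length minus the cost of the mistakes.

    - If one code has mean length below [h * N] under every invariant state, then by
      compactness its orbit averages are uniformly below [h * N], the repetitions of
      the code give every orbit of length [n] a likelihood of about
      [expR (- n * h)], and a separated set has total likelihood at most [2 ^ n].
      So [spanning_rate] is at most [h + ln 2] ([spanning_rate_le]).

    - Let [h] be the largest number such that for every code some invariant state
      has mean length at least [h] per letter.  Mixtures of codes and compactness
      give a single state that works for all codes, and the states with this
      property form a closed face, because a mixture of two states can be coded at
      nearly the mixture of their rates.  An extreme point of this face comes from a
      measure by [riesz_representation], which is ergodic by extremality
      ([ergodic_long_codes]). *)

(** * Continuous functions on a compact metric space *)

Section ContinuousFunctions.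
Context {R : realType} {X : pmetricType R}.
Implicit Types (f g : X -> R) (U : set X).

Lemma lipschitz_continuous (c : R) f :
  (forall x y, f x <= f y + c * mdist x y) -> continuous f.
Proof.
move=> lipf x; apply/cvgrPdist_lt => e e0.
have c0 : 0 < `|c| + 1 by rewrite ltr_wpDl.
near=> y.
have xy : mdist x y < e / (`|c| + 1).
  have : ball x (e / (`|c| + 1)) y.
    by near: y; apply: nbhsx_ballx; rewrite divr_gt0.
  by rewrite ballEmdist.
have d0 : 0 <= mdist x y by exact: mdist_ge0.
have cd : c * mdist x y < e.
  move: xy; rewrite ltr_pdivlMr// => /(le_lt_trans _); apply.
  by rewrite mulrC ler_wpM2l// (le_trans (ler_norm _))// lerDl.
have := lipf x y; have := lipf y x; rewrite (metric_sym y x) => h1 h2.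
by rewrite ltr_norml; apply/andP; split; lra.
Unshelve. all: by end_near. Qed.

Lemma continuous_mdistl (y : X) : continuous (fun x => mdist x y).
Proof.
apply: (@lipschitz_continuous 1) => x z; rewrite mul1r addrC.
exact: metric_triangle.
Qed.

Lemma open_urysohn_sequence U : open U -> exists g : nat -> X -> R,
  [/\ forall n, continuous (g n), forall n x, 0 <= g n x <= 1,
      forall n x, g n x <= g n.+1 x, forall n x, ~ U x -> g n x = 0 &
      forall x, U x -> exists n, g n x = 1].
Proof.
move=> oU.
pose D x := [set r | r = 1 \/ exists2 y, ~ U y & r = mdist x y].
pose phi x := inf (D x).
have lbD x : lbound (D x) 0.
  by move=> r [->//|[y _ ->]]; exact: mdist_ge0.
have hlD x : has_lbound (D x) by exists 0.
have D1 x : D x 1 by left.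
have D0 x : D x !=set0 by exists 1.
have phi0 x : 0 <= phi x by apply: lb_le_inf.
have lip x z : phi x <= phi z + 1 * mdist x z.
  rewrite mul1r -lerBlDr; apply: lb_le_inf => // r [->|[y Uy ->]].
    by rewrite lerBlDr (le_trans (ge_inf (hlD x) (D1 x)))// lerDl mdist_ge0.
  rewrite lerBlDr (@le_trans _ _ (mdist x y))//.
    by apply: ge_inf; [exact: hlD|right; exists y].
  by rewrite addrC; exact: metric_triangle.
exists (fun n x => Num.min 1 (n%:R * phi x)); split.
- move=> n; apply: (@lipschitz_continuous n%:R) => x y.
  have n0 : 0 <= n%:R :> R by [].
  have nd : 0 <= n%:R * mdist x y :> R by rewrite mulr_ge0// mdist_ge0.
  have := ler_wpM2l n0 (lip x y); rewrite mul1r mulrDr => h.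
  by rewrite !minEle; case: ifPn; case: ifPn; rewrite -?ltNge => ? ?; lra.
- move=> n x; rewrite le_min ler01 mulr_ge0//= ge_min lexx //.
- move=> n x; rewrite le_min !ge_min lexx/=; apply/orP; right.
  by rewrite ler_wpM2r// ler_nat.
- move=> n x Ux; have -> : phi x = 0.
    apply/eqP; rewrite eq_le phi0 andbT; apply: ge_inf => //.
    by right; exists x => //; rewrite mdistxx.
  by rewrite mulr0; apply/min_idPr.
- move=> x Ux.
  have /nbhs_ballP[r /= r0 rU] : nbhs x U by exact: open_nbhs_nbhs.
  have rphi : Num.min 1 r <= phi x.
    apply: lb_le_inf => // s [->|[y Uy ->]]; first by rewrite ge_min lexx.
    rewrite ge_min; apply/orP; right; rewrite leNgt; apply/negP => xy.
    by apply: Uy; apply: rU; rewrite ballEmdist.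
  have phi_gt0 : 0 < phi x by rewrite (lt_le_trans _ rphi)// lt_min ltr01.
  exists (Num.bound (phi x)^-1); apply/min_idPl.
  by rewrite -ler_pdivrMr// div1r ltW// archi_boundP// invr_ge0.
Qed.

Lemma continuous_borel_measurable f : continuous f ->
  measurable_fun [set: borel X] (f : borel X -> R).
Proof.
move=> cf; apply: (measurability _ (RGenOpens.measurableE R)).
move=> _ [_ [a [b ->] <-]]; rewrite setTI; apply: sub_sigma_algebra.
by move/continuousP : cf; apply; exact: interval_open.
Qed.

End ContinuousFunctions.

(** * Riesz representation on a compact metric space *)

Section States.
Context {R : realType} {X : pmetricType R}.
Implicit Types (f g : X -> R) (L : (X -> R) -> R).

Lemma continuous_addf f g : continuous f -> continuous g ->
  continuous (fun x => f x + g x).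
Proof. by move=> cf cg x; apply: cvgD; [exact: cf|exact: cg]. Qed.

Lemma continuous_mulf f g : continuous f -> continuous g ->
  continuous (fun x => f x * g x).
Proof. by move=> cf cg x; apply: cvgM; [exact: cf|exact: cg]. Qed.

Lemma continuous_subf f g : continuous f -> continuous g ->
  continuous (fun x => f x - g x).
Proof. by move=> cf cg x; apply: cvgB; [exact: cf|exact: cg]. Qed.

Lemma continuous_scalef (a : R) f : continuous f ->
  continuous (fun x => a * f x).
Proof. by move=> cf; apply: continuous_mulf => // x; exact: cvg_cst. Qed.

Lemma continuous_cstf (a : R) : continuous (fun _ : X => a).
Proof. by move=> x; exact: cvg_cst. Qed.

Lemma continuous_minf f g : continuous f -> continuous g ->
  continuous (fun x => Num.min (f x) (g x)).
Proof. by move=> cf cg x; exact: (continuous_min (cf x) (cg x)). Qed.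

Lemma continuous_maxf f g : continuous f -> continuous g ->
  continuous (fun x => Num.max (f x) (g x)).
Proof. by move=> cf cg x; exact: (continuous_max (cf x) (cg x)). Qed.

Lemma continuous_sumf I (r : seq I) (F : I -> X -> R) :
  (forall i, continuous (F i)) -> continuous (fun x => \sum_(i <- r) F i x).
Proof.
move=> cF; elim: r => [|i r IH].
  by under eq_fun do rewrite big_nil; exact: continuous_cstf.
by under eq_fun do rewrite big_cons; exact: continuous_addf.
Qed.

Lemma continuous_prodf I (r : seq I) (F : I -> X -> R) :
  (forall i, continuous (F i)) -> continuous (fun x => \prod_(i <- r) F i x).
Proof.
move=> cF; elim: r => [|i r IH].
  by under eq_fun do rewrite big_nil; exact: continuous_cstf.
by under eq_fun do rewrite big_cons; exact: continuous_mulf.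
Qed.

(** Expectations, before they are known to come from measures.  [L] takes all
    functions as arguments, so that states are points of a power of [R], but is
    only constrained at continuous ones. *)
Record state L : Prop := State {
  stateD : forall f g, continuous f -> continuous g ->
    L (fun x => f x + g x) = L f + L g;
  stateZ : forall a f, continuous f -> L (fun x => a * f x) = a * L f;
  state_ge0 : forall f, continuous f -> (forall x, 0 <= f x) -> 0 <= L f;
  state1 : L (fun=> 1) = 1 }.

Section StateTheory.
Variable L : (X -> R) -> R.
Hypothesis sL : state L.

Lemma state_cst a : L (fun=> a) = a.
Proof.
rewrite -[RHS]mulr1 -[X in _ = a * X](state1 sL) -stateZ//.
  by under [in RHS]eq_fun do rewrite mulr1.
exact: continuous_cstf.
Qed.

Lemma stateB f g : continuous f -> continuous g ->
  L (fun x => f x - g x) = L f - L g.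
Proof.
move=> cf cg; rewrite -mulN1r -(stateZ sL)//.
rewrite -(stateD sL)//; last exact: continuous_scalef.
by under [in RHS]eq_fun do rewrite mulN1r.
Qed.

Lemma le_state f g : continuous f -> continuous g ->
  (forall x, f x <= g x) -> L f <= L g.
Proof.
move=> cf cg fg; rewrite -subr_ge0 -stateB//; apply: (state_ge0 sL) => [|x].
  exact: continuous_subf.
by rewrite subr_ge0.
Qed.

Lemma state_sum I (r : seq I) (F : I -> X -> R) :
  (forall i, continuous (F i)) ->
  L (fun x => \sum_(i <- r) F i x) = \sum_(i <- r) L (F i).
Proof.
move=> cF; elim: r => [|i r IH].
  by under eq_fun do rewrite big_nil; rewrite state_cst big_nil.
under eq_fun do rewrite big_cons.
by rewrite big_cons -IH -stateD//; exact: continuous_sumf.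
Qed.

End StateTheory.
End States.

Section Riesz.
Context {R : realType} {X : pmetricType R}.
Hypothesis compactX : compact [set: X].

Lemma compact_continuous_bounded (f : X -> R) : continuous f ->
  exists M : R, forall x, `|f x| <= M.
Proof.
move=> cf; have /compact_bounded[M [_ fM]] : compact (range f).
  by apply: continuous_compact => //; exact: continuous_subspaceT.
exists (M + 1) => x; apply: fM; first by rewrite ltrDl.
by exists x.
Qed.

Lemma continuous_integrable (mu : probability (borel X) R) (f : X -> R) :
  continuous f -> mu.-integrable setT (EFin \o (f : borel X -> R)).
Proof.
move=> cf; apply: measurable_bounded_integrable => //.
- by rewrite (le_lt_trans (probability_le1 mu measurableT))// ltry.
- exact: continuous_borel_measurable.
- have [M fM] := compact_continuous_bounded cf.
  exists M; split; first exact: num_real.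
  by move=> y My x _; rewrite /= (le_trans (fM x))// ltW.
Qed.

Definition expected_value (mu : probability (borel X) R) (f : X -> R) : R :=
  (\int[mu]_x (f : borel X -> R) x)%R.

Lemma state_expected_value (mu : probability (borel X) R) :
  state (expected_value mu).
Proof.
split.
- by move=> f g cf cg; apply: RintegralD => //; exact: continuous_integrable.
- by move=> a f cf; apply: RintegralZl => //; exact: continuous_integrable.
- by move=> f cf f0; apply: Rintegral_ge0.
- rewrite /expected_value Rintegral_cst//.
  by rewrite [X in fine X](_ : _ = 1%E) ?mulr1//; exact: probability_setT.
Qed.

(** The open sets generate the Borel sets and their indicators are increasing
    limits of continuous functions, so that a state has at most one representing
    measure. *)
Lemma eq_measure_expected_value (mu nu : probability (borel X) R) :
  (forall f, continuous f -> expected_value mu f = expected_value nu f) ->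
  forall A : set (borel X), measurable A -> mu A = nu A.
Proof.
move=> munu.
move=> A mA; apply: (@measure_unique _ R (borel X) (@open X) (fun=> setT)
  _ _ _ _ mu nu _ _ A mA) => //.
- exact: openI.
- by move=> _; exact: openT.
- by rewrite bigcup_const.
- move=> U oU; have [g [cg g01 ndg g0 g1]] := open_urysohn_sequence oU.
  have mU : measurable (U : set (borel X)) by exact: sub_sigma_algebra.
  have g_le m n x : (m <= n)%N -> g m x <= g n x.
    by move=> /subnK <-; elim: (n - m)%N => // k /le_trans; apply; exact: ndg.
  have cvgg (m : probability (borel X) R) :
      (\int[m]_x (g n x)%:E)%E @[n --> \oo] --> m U.
    rewrite -[U]setIT -(integral_indic m measurableT)//.
    have -> : (fun x : borel X => (\1_U x)%:E : \bar R) =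
        (fun x : borel X => limn (fun n => (g n x)%:E)).
      apply/funext => x; apply/esym/cvg_lim => //; apply: cvg_near_cst.
      have [Ux|Ux] := pselect (U x).
        have [n gn1] := g1 _ Ux; exists n => // k /= nk; congr EFin.
        rewrite indicE mem_set//; apply/eqP; rewrite eq_le -{2}gn1 g_le// andbT.
        by have /andP[] := g01 k x.
      by apply: nearW => n; rewrite g0// indicE memNset.
    apply: (@cvg_monotone_convergence _ _ _ m setT _
      (fun n (x : borel X) => (g n x)%:E)) => //.
    + by move=> n; apply/measurable_EFinP; exact: continuous_borel_measurable.
    + by move=> n x _; rewrite lee_fin; have /andP[] := g01 n x.
    + by move=> x _ i j ij; rewrite lee_fin g_le.
  have E n : (\int[mu]_x (g n x)%:E = \int[nu]_x (g n x)%:E)%E.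
    have := munu _ (cg n); rewrite /expected_value /Rintegral.
    move=> fE; have := congr1 (@EFin R) fE; rewrite !fineK//; apply: integrable_fin_num => //;
      exact: continuous_integrable.
  apply: (cvg_unique _ (cvgg mu)) => //.
  by rewrite (_ : (fun n => _) = (fun n => \int[nu]_x (g n x)%:E)%E);
    [exact: cvgg|exact/funext].
- by move=> _; rewrite (le_lt_trans (probability_le1 mu measurableT))// ltry.
Qed.

End Riesz.

Section RieszConstruction.
Context {R : realType} {X : pmetricType R}.
Hypothesis compactX : compact [set: X].
Variable L : (X -> R) -> R.
Hypothesis sL : state L.
Implicit Types (A B U : set X) (f : nat -> X -> R).

(** Covers are increasing sequences rather than series of continuous functions: a
    countable union of sets is then covered by the diagonal partial sums of their
    covers, without double series. *)
Definition dominated A (c : R) := exists f,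
  [/\ forall n, continuous (f n), forall n x, 0 <= f n x,
      forall n x, f n x <= f n.+1 x,
      forall x, A x -> forall e, 0 < e -> exists n, 1 - e < f n x &
      forall n, L (f n) <= c].

Definition daniell_outer A : R := inf [set c | dominated A c].

Lemma increasing_le f n m x : (forall n x, f n x <= f n.+1 x) ->
  (n <= m)%N -> f n x <= f m x.
Proof.
move=> ndf /subnK <-; elim: (m - n)%N => // k /le_trans; apply; exact: ndf.
Qed.

Lemma dominated_const A (h : X -> R) : continuous h -> (forall x, 0 <= h x) ->
  (forall x, A x -> 1 <= h x) -> dominated A (L h).
Proof.
move=> ch h0 h1; exists (fun=> h); split=> // x Ax e e0.
by exists 0%N; rewrite (lt_le_trans _ (h1 x Ax))// ltrBlDr ltrDl.
Qed.

Lemma dominated1 A : dominated A 1.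
Proof.
rewrite -(state1 sL); apply: dominated_const => //; exact: continuous_cstf.
Qed.

Lemma dominated_ge0 A c : dominated A c -> 0 <= c.
Proof.
by move=> [f [cf f0 _ _ fc]]; rewrite (le_trans _ (fc 0%N))// (state_ge0 sL).
Qed.

Lemma has_inf_dominated A : has_inf [set c | dominated A c].
Proof.
split; first by exists 1; exact: dominated1.
by exists 0 => c; exact: dominated_ge0.
Qed.

Lemma daniell_outer_le A c : dominated A c -> daniell_outer A <= c.
Proof. by move=> Ac; apply: ge_inf => //; case: (has_inf_dominated A). Qed.

Lemma daniell_outer_glb A c : (forall b, dominated A b -> c <= b) ->
  c <= daniell_outer A.
Proof. by move=> h; apply: lb_le_inf => //; case: (has_inf_dominated A). Qed.

Lemma daniell_outer_ge0 A : 0 <= daniell_outer A.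
Proof. by apply: daniell_outer_glb => c; exact: dominated_ge0. Qed.

Lemma daniell_outer_set0 : daniell_outer set0 = 0.
Proof.
apply/eqP; rewrite eq_le daniell_outer_ge0 andbT; apply: daniell_outer_le.
rewrite -(state_cst sL 0); apply: dominated_const => //.
exact: continuous_cstf.
Qed.

Lemma le_daniell_outer A B : A `<=` B -> daniell_outer A <= daniell_outer B.
Proof.
move=> AB; apply: daniell_outer_glb => c [f [cf f0 ndf fB fc]].
apply: daniell_outer_le; exists f; split=> // x /AB; exact: fB.
Qed.

Lemma daniell_outer_sigma_subadditive :
  sigma_subadditive (fun A => (daniell_outer A)%:E : \bar R).
Proof.
move=> F; apply/lee_addgt0Pr => e e0.
set S := (\sum_(i <oo) _)%E.
have S0 : (0 <= S)%E by apply: nneseries_ge0 => *; rewrite lee_fin daniell_outer_ge0.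
have [->|Sfin] := eqVneq S +oo%E; first by rewrite addye// leey.
have {Sfin} Sfin : S \is a fin_num by rewrite ge0_fin_numE// lt_neqAle Sfin leey.
have /choice[c cP] k : exists c, dominated (F k) c /\
    c < daniell_outer (F k) + e / (2 ^ k.+1)%:R.
  have [|c Dc cl] := @inf_adherent _ [set c | dominated (F k) c]
      (e / (2 ^ k.+1)%:R) _ (has_inf_dominated _).
    by rewrite divr_gt0.
  by exists c.
have [f fP] := choice (fun k => (cP k).1).
rewrite -(fineK Sfin) -EFinD lee_fin; apply: daniell_outer_le.
exists (fun n x => \sum_(k < n) f k n x); split.
- by move=> n; apply: continuous_sumf => k; case: (fP k).
- by move=> n x; apply: sumr_ge0 => k _; case: (fP k).
- move=> n x; rewrite big_ord_recr/= ler_wpDr//; first by case: (fP n).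
  by apply: ler_sum => k _; case: (fP k).
- move=> x [k _ Fkx] d d0; have [_ f0 ndf fF _] := fP k.
  have [n nf] := fF _ Fkx _ d0; exists (maxn n k.+1).
  rewrite (lt_le_trans nf)//.
  rewrite (bigD1 (Ordinal (leq_maxr n k.+1)))//= ler_wpDr//.
    by apply: sumr_ge0 => i _; case: (fP i).
  by apply: increasing_le => //; rewrite leq_maxl.
- move=> n; rewrite (state_sum sL); last by move=> k; case: (fP k).
  rewrite -lee_fin EFinD fineK//.
  apply: le_trans (epsilon_trick xpredT _ _) => //; last 2 first.
    + by move=> k; rewrite lee_fin daniell_outer_ge0.
    + exact: ltW.
  apply: le_trans (nneseries_lim_ge n _); last first.
    move=> k _ _; rewrite -EFinD lee_fin addr_ge0// ?daniell_outer_ge0//.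
    by rewrite divr_ge0// ltW.
  rewrite big_mkord -sumEFin; apply: lee_sum => k _; rewrite lee_fin.
  have [_ _ _ _ fc] := fP k; rewrite (le_trans (fc n))// ltW//.
  by have [_ +] := cP k; rewrite natrX.
Qed.

(** A sequence dominating [A] is split by an open set [U]: multiplying it by
    functions increasing to the indicator of [U] dominates the trace on [U], and
    multiplying by one minus these functions dominates the rest. *)
Lemma daniell_outer_open U A : open U ->
  daniell_outer (A `&` U) + daniell_outer (A `&` ~` U) <= daniell_outer A.
Proof.
move=> oU; have [g [cg g01 ndg g0 g1]] := open_urysohn_sequence oU.
have g_ge0 n x : 0 <= g n x by case/andP: (g01 n x).
have g_le1 n x : g n x <= 1 by case/andP: (g01 n x).
apply: daniell_outer_glb => c [f [cf f0 ndf fA fc]].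
rewrite -lerBrDr; apply: daniell_outer_le.
exists (fun n x => f n x * g n x); split.
- by move=> n; apply: continuous_mulf.
- by move=> n x; rewrite mulr_ge0.
- by move=> n x; rewrite ler_pM.
- move=> x [Ax Ux] e e0; have [n nf] := fA x Ax e e0.
  have [m mg] := g1 x Ux; exists (maxn n m).
  have -> : g (maxn n m) x = 1.
    apply/eqP; rewrite eq_le g_le1/= -mg increasing_le//; exact: leq_maxr.
  by rewrite mulr1 (lt_le_trans nf)// increasing_le//; exact: leq_maxl.
- move=> m; rewrite lerBrDr -lerBrDl; apply: daniell_outer_le.
  exists (fun n x => f n x * (1 - g m x)); split.
  + move=> n; apply: continuous_mulf => //; apply: continuous_subf => //.
    exact: continuous_cstf.
  + by move=> n x; rewrite mulr_ge0// subr_ge0.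
  + by move=> n x; rewrite ler_wpM2r// subr_ge0.
  + move=> x [Ax Ux] e e0; have [n nf] := fA x Ax e e0; exists n.
    by rewrite g0// subr0 mulr1.
  + move=> n; rewrite lerBrDl -(stateD sL); [|exact: continuous_mulf|]; last first.
      apply: continuous_mulf => //; apply: continuous_subf => //.
      exact: continuous_cstf.
    apply: le_trans (fc (maxn n m)); apply: (le_state sL) => //.
      apply: continuous_addf; apply: continuous_mulf => //.
      by apply: continuous_subf => //; exact: continuous_cstf.
    move=> x; set N := maxn n m.
    apply: (@le_trans _ _ (f N x * g m x + f N x * (1 - g m x))); last first.
      by rewrite -mulrDr subrKC mulr1.
    apply: lerD; rewrite ler_wpM2r ?subr_ge0// increasing_le//.
      exact: leq_maxr.
    exact: leq_maxl.
Qed.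

Lemma daniell_outer_setT : daniell_outer setT = 1.
Proof.
apply/eqP; rewrite eq_le daniell_outer_le/=; last exact: dominated1.
apply: daniell_outer_glb => c [f [cf f0 ndf fT fc]].
apply/ler_addgt0Pl => e e0; rewrite -lerBlDl.
suff [n fn] : exists n, forall x, 1 - e <= f n x.
  apply: le_trans (fc n); rewrite -(state_cst sL (1 - e)).
  by apply: (le_state sL) => //; exact: continuous_cstf.
have := compactX; rewrite compact_cover => /(_ nat setT
  (fun n => f n @^-1` [set r | 1 - e < r])).
case.
- by move=> n _; apply: open_comp => [x _|]; [exact: cf|exact: open_gt].
- by move=> x _; have [n nf] := fT x I e e0; exists n.
move=> D _ cov; exists (\max_(i <- D) i)%N => x.
have [i /= iD fi] := cov x I; rewrite (le_trans (ltW fi))// increasing_le//.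
exact: (@leq_bigmax_seq _ _ xpredT id).
Qed.

Lemma riesz_measure : exists mu : probability (borel X) R,
  forall A, mu A = (daniell_outer A)%:E.
Proof.
pose om : set X -> \bar R := fun A => (daniell_outer A)%:E.
have om0 : om set0 = 0%E by rewrite /om daniell_outer_set0.
have om_ge0 A : (0 <= om A)%E by rewrite lee_fin daniell_outer_ge0.
have le_om : {homo om : A B / A `<=` B >-> (A <= B)%E}.
  by move=> A B AB; rewrite lee_fin le_daniell_outer.
pose m : {outer_measure set X -> \bar R} := HB.pack om
  (isOuterMeasure.Build R X om om0 om_ge0 le_om daniell_outer_sigma_subadditive).
have borel_cara : <<s @open X >> `<=` m.-caratheodory.
  apply: (smallest_sub (@sigma_algebra_measurable _ (caratheodory_type m))).
  move=> U oU; apply: le_caratheodory_measurable => A.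
  by rewrite -EFinD lee_fin daniell_outer_open.
pose nu : set (borel X) -> \bar R := om.
have nusa : semi_sigma_additive nu.
  move=> F mF tF mUF; apply: (@caratheodory_measure_sigma_additive R X m) => //.
  - by move=> i; apply: borel_cara; exact: mF.
  - exact: borel_cara.
have nu1 : nu setT = 1%E by rewrite /nu /om daniell_outer_setT.
pose nuM : {measure set (borel X) -> \bar R} := HB.pack nu
  (isMeasure.Build _ _ _ nu om0 om_ge0 nusa).
pose nuP : probability (borel X) R := HB.pack nu
  (Measure.on nuM) (Measure_isProbability.Build _ _ _ nuM nu1).
by exists nuP.
Qed.

End RieszConstruction.

Section RieszRepresentation.
Context {R : realType} {X : pmetricType R}.
Hypothesis compactX : compact [set: X].
Implicit Types (L : (X -> R) -> R) (f : X -> R).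

(** The layers of the layer cake formula; [sum_slice] puts them together. *)
Definition slice (j : nat) (t : R) : R := Num.min 1 (Num.max 0 (t - j%:R)).

Lemma slice_ge0 j t : 0 <= slice j t.
Proof. by rewrite le_min ler01 le_max lexx. Qed.

Lemma slice_le1 j t : slice j t <= 1.
Proof. by rewrite ge_min lexx. Qed.

Lemma slice_eq0 j t : t <= j%:R -> slice j t = 0.
Proof.
by move=> tj; rewrite /slice (max_idPl _) ?subr_le0//; apply/min_idPr.
Qed.

Lemma slice_eq1 j t : j.+1%:R <= t -> slice j t = 1.
Proof.
move=> tj; have h : 1 <= t - j%:R by rewrite lerBrDr -natr1 addrC in tj *.
by apply/min_idPl; rewrite le_max h orbT.
Qed.

Lemma sum_slice n t : 0 <= t <= n%:R -> \sum_(j < n) slice j t = t.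
Proof.
elim: n t => [|n IH] t /andP[t0 tn].
  by rewrite big_ord0; apply/eqP; rewrite eq_le t0 tn.
rewrite big_ord_recr/=; have [tn'|tn'] := leP t n%:R.
  by rewrite slice_eq0// addr0 IH// t0.
rewrite (eq_bigr (fun=> 1)) => [|j _].
  rewrite sumr_const card_ord /slice (max_idPr _) ?subr_ge0 ?ltW//.
  rewrite (min_idPr _) ?subrKC//.
  by rewrite lerBlDr (le_trans tn)// -natr1 addrC.
by rewrite slice_eq1// (le_trans _ (ltW tn'))// ler_nat.
Qed.

Lemma continuous_slice j f : continuous f -> continuous (fun x => slice j (f x)).
Proof.
move=> cf; apply: continuous_minf; first exact: continuous_cstf.
apply: continuous_maxf; first exact: continuous_cstf.
by apply: continuous_subf => //; exact: continuous_cstf.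
Qed.

Lemma expected_value_le_state L (sL : state L) (mu : probability (borel X) R) :
  (forall A, mu A = (daniell_outer L A)%:E) ->
  forall f, continuous f -> expected_value mu f <= L f.
Proof.
move=> muL; have sE := state_expected_value compactX mu.
(* the slice above height j + 1 is at most the indicator of {f >= j + 1}, which
   is at most the slice above height j *)
have slice_le f j : continuous f ->
    expected_value mu (fun x => slice j.+1 (f x)) <= L (fun x => slice j (f x)).
  move=> cf; pose A := [set x | j.+1%:R <= f x].
  have mA : measurable (A : set (borel X)).
    have -> : A = setT `&` f @^-1` [set` `[j.+1%:R, +oo[].
      by apply/seteqP; split => [x fx|x [_]]; rewrite /= in_itv/= andbT.
    exact: (continuous_borel_measurable cf measurableT (measurable_itv _)).
  apply: (@le_trans _ _ (fine (mu A))); last first.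
    rewrite muL/=; apply: (daniell_outer_le sL); apply: dominated_const => //.
    - exact: continuous_slice.
    - by move=> x; exact: slice_ge0.
    - by move=> x Ax; rewrite slice_eq1.
  rewrite /expected_value /Rintegral -[A]setIT -(integral_indic mu measurableT)//.
  apply: fine_le.
  - apply: integrable_fin_num => //; apply: continuous_integrable => //.
    exact: continuous_slice.
  - by rewrite integral_indic// setIT fin_num_measure.
  - apply: ge0_le_integral => //.
    + by move=> x _; rewrite lee_fin slice_ge0.
    + apply/measurable_EFinP; apply: continuous_borel_measurable.
      exact: continuous_slice.
    + by apply/measurable_EFinP; exact: measurable_indic.
    + move=> x _; rewrite lee_fin indicE; have [xA|] := boolP (x \in A).
        exact: slice_le1.
      move=> xA; rewrite slice_eq0// ltW// ltNge; apply/negP => fx.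
      by move/negP: xA; apply; rewrite inE.
have unit_case f : continuous f -> (forall x, 0 <= f x <= 1) ->
    expected_value mu f <= L f.
  move=> cf f01; apply/ler_addgt0Pl => e e0.
  pose n := Num.bound e^-1.
  have ne : e^-1 < n%:R by rewrite archi_boundP// invr_ge0 ltW.
  have n0 : 0 < n%:R :> R by rewrite (lt_trans _ ne)// invr_gt0.
  have n_gt0 : (0 < n)%N by rewrite -(ltr_nat R).
  have cnf : continuous (fun x => n%:R * f x) by exact: continuous_scalef.
  have nfE : (fun x => n%:R * f x) =
      (fun x => \sum_(j < n) slice j (n%:R * f x)).
    apply/funext => x; rewrite sum_slice//; have /andP[? ?] := f01 x.
    by rewrite mulr_ge0//= ler_piMr.
  rewrite -(ler_pM2l n0) mulrDr -(stateZ sE _ cf) -(stateZ sL _ cf) nfE.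
  have cslice j : continuous (fun x => slice j (n%:R * f x)).
    exact: continuous_slice.
  rewrite (state_sum sE)// (state_sum sL)//.
  move: n_gt0 {nfE cslice} ne n0 cnf; case: n => // n _ ne n0 cnf.
  rewrite big_ord_recl big_ord_recr/=; apply: lerD.
    apply: (@le_trans _ _ 1).
      rewrite -[leRHS](state_cst sE); apply: (le_state sE) => [||x].
      - exact: continuous_slice.
      - exact: continuous_cstf.
      - exact: slice_le1.
    rewrite mulrC -ler_pdivrMl// mulr1; exact: ltW.
  rewrite -[leLHS]addr0; apply: lerD.
    by apply: ler_sum => j _; exact: (slice_le _ _ cnf).
  by apply: (state_ge0 sL) => [|x]; [exact: continuous_slice|exact: slice_ge0].
move=> f cf; have [M fM] := compact_continuous_bounded compactX cf.
have M0 : 0 <= M by rewrite (le_trans _ (fM point)).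
pose a := (2 * (M + 1))^-1; have a0 : 0 < a by rewrite invr_gt0 mulr_gt0// ltr_wpDl.
have cg : continuous (fun x => a * f x + 2^-1).
  by apply: continuous_addf; [exact: continuous_scalef|exact: continuous_cstf].
have := unit_case _ cg.
have caf : continuous (fun x => a * f x) by exact: continuous_scalef.
have c2 : continuous (fun _ : X => 2^-1 : R) by exact: continuous_cstf.
rewrite (stateD sE)// (stateD sL)// (stateZ sE)// (stateZ sL)//.
rewrite (state_cst sE) (state_cst sL) lerD2r ler_pM2l//; apply => x.
have h : a * (M + 1) = 2^-1 by rewrite /a invfM -mulrA mulVf ?mulr1// gt_eqF// ltr_wpDl.
have : `|a * f x| <= 2^-1.
  by rewrite -h normrM gtr0_norm// ler_pM2l// (le_trans (fM x))// lerDl.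
rewrite ler_norml => /andP[h1 h2]; apply/andP; split; lra.
Qed.

Theorem riesz_representation L : state L -> exists mu : probability (borel X) R,
  forall f, continuous f -> expected_value mu f = L f.
Proof.
move=> sL; have [mu muL] := riesz_measure compactX sL; exists mu => f cf.
have sE := state_expected_value compactX mu.
apply/eqP; rewrite eq_le (expected_value_le_state sL muL cf)/= -lerN2.
rewrite -(mulN1r (L f)) -(mulN1r (expected_value mu f)) -(stateZ sE)// -(stateZ sL)//.
by apply: expected_value_le_state => //; exact: continuous_scalef.
Qed.

End RieszRepresentation.

(** * Extreme points of compact sets of functionals *)

Section Compactness.

(** The traces of the [C i] on [K] generate a filter, a cluster point of which is
    in all of them. *)
Lemma compact_directed_bigcap (V : topologicalType) (K : set V)
    (I : Type) (D : set I) (C : I -> set V) :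
  compact K -> D !=set0 -> (forall i, D i -> closed (C i)) ->
  (forall i, D i -> K `&` C i !=set0) ->
  (forall i j, D i -> D j -> exists2 k, D k & K `&` C k `<=` C i `&` C j) ->
  exists2 p, K p & forall i, D i -> C i p.
Proof.
move=> cK [i0 Di0] clC KC dirC.
have FF : Filter (filter_from D (fun i => K `&` C i)).
  apply: filter_from_filter; first by exists i0.
  move=> i j Di Dj; have [k Dk kij] := dirC i j Di Dj; exists k => //.
  by move=> p [Kp Cp]; have [Cip Cjp] := kij p (conj Kp Cp).
have PF : ProperFilter (filter_from D (fun i => K `&` C i)).
  exact: (@filter_from_proper _ _ D _ FF KC).
have [|p [Kp clp]] := cK _ PF; first by exists i0 => // p [].
exists p => // i Di; apply: (clC i Di) => B Bp.
have [|q [[_ Cq] Bq]] := clp (K `&` C i) B _ Bp; first by exists i.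
by exists q.
Qed.

End Compactness.

Section ExtremePoints.
Context {R : realType} {F : Type}.
Local Notation V := {ptws F -> R}.
Implicit Types (K M E : set V) (L : V).

Definition mixture (t : R) (L1 L2 : V) : V := fun f => t * L1 f + (1 - t) * L2 f.

Definition face K M := forall t L1 L2, 0 < t < 1 -> K L1 -> K L2 ->
  M (mixture t L1 L2) -> M L1 /\ M L2.

Lemma ptws_eval_continuous (f : F) : continuous (fun L => L f).
Proof. exact: (@proj_continuous {classic F} (fun=> R) f). Qed.

Lemma closed_eval_ge (f : F) (c : R) : closed [set L : V | c <= L f].
Proof.
apply: (@preimage_closed _ _ (fun L : V => L f) [set r | c <= r]).
  by move=> L _; exact: ptws_eval_continuous.
exact: closed_ge.
Qed.

(** The functionals of a closed face whose value at some [f] is maximal form a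
    closed face again, so that a minimal closed face is a point; and a face that is
    a point is extreme. *)
Lemma face_extreme_point K M : compact K -> closed M -> M `<=` K ->
  face K M -> M !=set0 ->
  exists2 L0, M L0 & forall t L1 L2, 0 < t < 1 -> K L1 -> K L2 ->
    L0 = mixture t L1 L2 -> L1 = L0.
Proof.
move=> cK clM MK faceM [m Mm].
have cM : compact M by apply: subclosed_compact MK.
pose P (U : set V) := [/\ open U, M `\` U !=set0 & face K (M `\` U)].
have [U [[oU [L0 [ML0 UL0]] faceU] maxU]] : exists U, P U /\
    forall B, U `<` B -> ~ P B.
  apply: Zorn_bigcup => C CP totC; split.
  - by apply: bigcup_open => U /CP[].
  - have [[U0 CU0]|C0] := pselect (C !=set0); last first.
      by exists m; split=> // -[U CU _]; apply: C0; exists U.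
    have [|U /CP[oU _ _]|U /CP[_ [L [ML UL]] _]|U W CU CW|L ML LC] :=
      @compact_directed_bigcap _ _ _ C (fun U => ~` U) cM.
    + by exists U0.
    + exact: open_closedC.
    + by exists L.
    + by have [UW|WU] := totC U W CU CW; [exists W|exists U] => // L [_ h];
        split => // ?; apply: h; [exact: UW|exact: WU].
    + by exists L; split=> // -[U CU]; exact: LC.
  - move=> t L1 L2 t01 K1 K2 [Mt Ct]; have [M1 M2] := faceM _ _ _ t01 K1 K2 Mt.
    split; split=> // -[U CU UL]; have [_ _ fU] := CP _ CU;
      have [] := fU t L1 L2 t01 K1 K2.
    + by split=> // Ut; apply: Ct; exists U.
    + by move=> [_].
    + by split=> // Ut; apply: Ct; exists U.
    + by move=> _ [_].
exists L0 => //.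
have clE : closed (M `\` U).
  by rewrite setDE; apply: closedI => //; exact: open_closedC.
have cE : compact (M `\` U) by apply: subclosed_compact cM _ => // L [].
have eqE f L L' : M L -> ~ U L -> M L' -> ~ U L' -> L f = L' f.
  have [Lf [/set_mem[MLf ULf] maxLf]] : exists Lf,
      Lf \in M `\` U /\ forall L, L \in M `\` U -> L f <= Lf f.
    have [|//||Lf ? ?] := @compact_EVT_max V R (fun L => L f) (M `\` U).
    - by exists L0.
    - by apply: continuous_subspaceT; exact: ptws_eval_continuous.
    - by exists Lf.
  (* the complement of [B] is the part of the face where [f] is maximal *)
  pose B := U `|` ~` [set L : V | Lf f <= L f].
  suff BU : B `<=` U.
    have top N : M N -> ~ U N -> N f = Lf f.
      move=> MN UN; apply/eqP; rewrite eq_le maxLf ?inE//=.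
      by rewrite leNgt; apply/negP => Nf; apply: UN; apply: BU; right => /=;
        rewrite leNgt Nf.
    by move=> ? ? ? ?; rewrite !top.
  apply: contrapT => BU; apply: (maxU B).
    by split => //; exact: subsetUl.
  split.
  - by apply: openU => //; apply: closed_openC; exact: closed_eval_ge.
  - by exists Lf; split=> // -[//|]; apply => /=.
  - move=> t L1 L2 t01 K1 K2 [Mt Bt].
    have Ut : ~ U (mixture t L1 L2) by move=> ?; apply: Bt; left.
    have ft : Lf f <= mixture t L1 L2 f.
      by apply: contrapT => h; apply: Bt; right.
    have [[M1 U1] [M2 U2]] := faceU _ _ _ t01 K1 K2 (conj Mt Ut).
    have l1 := maxLf L1 (mem_set (conj M1 U1)).
    have l2 := maxLf L2 (mem_set (conj M2 U2)).
    move: t01 => /andP[t0 t1]; rewrite /mixture in ft.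
    by split; split => //; move=> [//|]; apply => /=; nra.
move=> t L1 L2 t01 K1 K2 L0E; have [[M1 U1] _] : (M `\` U) L1 /\ (M `\` U) L2.
  by apply: (faceU t) => //; rewrite -L0E.
by apply/funext => f; exact: eqE.
Qed.

End ExtremePoints.

(** * Invariant states *)

Section InvariantStates.
Context {R : realType} {X : pmetricType R}.
Variable T : X -> X.
Hypothesis compactX : compact [set: X].
Hypothesis contT : continuous T.
Local Notation V := {ptws (X -> R) -> R}.
Implicit Types (L : V) (f g : X -> R).

(** Vanishing at discontinuous functions makes the set of invariant states
    bounded, hence compact. *)
Definition invariant_state L :=
  [/\ state L, forall f, continuous f -> L (f \o T) = L f &
      forall f, ~ continuous f -> L f = 0].

Lemma continuous_iter i : continuous (iter i T).
Proof.
elim: i => [|i IH] x; first exact: cvg_id.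
by apply: (@cvg_comp _ _ _ (iter i T) T); [exact: IH|exact: contT].
Qed.

Lemma continuous_comp_iter f i : continuous f ->
  continuous (fun x => f (iter i T x)).
Proof.
move=> cf x; apply: (@cvg_comp _ _ _ (iter i T) f); last exact: cf.
exact: continuous_iter.
Qed.

Lemma closed_eval_eq (phi psi : V -> R) : continuous phi -> continuous psi ->
  closed [set L : V | phi L = psi L].
Proof.
move=> cphi cpsi.
have -> : [set L : V | phi L = psi L] =
    (fun L : V => phi L - psi L) @^-1` [set r | r = 0].
  by apply/seteqP; split => L /= => [->|/eqP]; rewrite ?subrr// subr_eq0 => /eqP.
apply: preimage_closed; last exact: closed_eq.
by move=> L _; exact: (continuousB (cphi L) (cpsi L)).
Qed.

(** Tychonoff's theorem for the intervals to which the values of states are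
    confined. *)
Lemma state_box : exists b : (X -> R) -> R,
  [/\ forall f x, continuous f -> `|f x| <= b f, forall f, 0 <= b f &
      compact [set L : V | forall f, `|L f| <= b f]].
Proof.
have /choice[b bP] (f : X -> R) : exists M : R,
    (forall x, continuous f -> `|f x| <= M) /\ 0 <= M.
  have [cf|ncf] := pselect (continuous f); last by exists 0; split => // x.
  have [M fM] := compact_continuous_bounded compactX cf; exists M; split=> //.
  by rewrite (le_trans _ (fM point)).
exists b; split => [f x|f|]; [by apply: (bP f).1|by case: (bP f)|].
have -> : [set L : V | forall f, `|L f| <= b f] =
    [set L : V | forall f, `[- b f, b f]%classic (L f)].
  by apply/seteqP; split => L /= Lb f; have := Lb f; rewrite /= in_itv/= ler_norml.
apply: (@tychonoff {classic (X -> R)} (fun=> R) (fun f => `[- b f, b f]%classic)).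
by move=> f; exact: segment_compact.
Qed.

Lemma state_normr_le L f c : state L -> continuous f ->
  (forall x, `|f x| <= c) -> `|L f| <= c.
Proof.
move=> sL cf fc; rewrite ler_norml.
rewrite -[X in X <= _ <= _](state_cst sL) -[X in _ <= _ <= X](state_cst sL).
by apply/andP; split; apply: (le_state sL) => //; try exact: continuous_cstf;
  move=> x; have := fc x; rewrite ler_norml => /andP[].
Qed.

Lemma closed_invariant_state : closed [set L | invariant_state L].
Proof.
have ev := @ptws_eval_continuous R (X -> R).
have clforall (I : Type) (P : I -> Prop) (A : I -> set V) :
    (forall i, P i -> closed (A i)) -> closed [set L | forall i, P i -> A i L].
  by move=> clA; exact: (closed_bigI clA).
move=> L clL.
have sub (A : set V) : closed A ->
    (forall L, invariant_state L -> A L) -> A L.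
  by move=> clA subA; apply: clA => B /clL[M [iM BM]]; exists M; split => //; exact: subA.
split; [split|..].
- move=> f g cf cg.
  apply: (sub [set L : V | L (fun x => f x + g x) = L f + L g]) => [|M []].
    by apply: closed_eval_eq => // M; exact: (continuousD (ev _ M) (ev _ M)).
  by move=> sM _ _; exact: stateD.
- move=> a f cf.
  apply: (sub [set L : V | L (fun x => a * f x) = a * L f]) => [|M []].
    by apply: closed_eval_eq => // M; exact: (continuousM (@cst_continuous _ _ a M) (ev f M)).
  by move=> sM _ _; exact: stateZ.
- move=> f cf f0; apply: (sub [set L : V | 0 <= L f]) => [|M []].
    exact: closed_eval_ge.
  by move=> sM _ _; exact: state_ge0.
- apply: (sub [set L : V | L (fun=> 1) = 1]) => [|M []].
    apply: closed_eval_eq => //; exact: cst_continuous.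
  by move=> sM _ _; exact: state1.
- move=> f cf; apply: (sub [set L : V | L (f \o T) = L f]) => [|M []].
    exact: closed_eval_eq.
  by move=> _ + _; apply.
- move=> f ncf; apply: (sub [set L : V | L f = 0]) => [|M []].
    apply: closed_eval_eq => //; exact: cst_continuous.
  by move=> _ _; apply.
Qed.

Lemma compact_invariant_state : compact [set L | invariant_state L].
Proof.
have [b [fb b0 cb]] := state_box.
apply: (subclosed_compact closed_invariant_state cb) => L [sL _ L0] f /=.
have [cf|ncf] := pselect (continuous f); last by rewrite L0// normr0.
by apply: state_normr_le => // x; exact: fb.
Qed.

(** A cluster point of longer and longer empirical averages is invariant, since
    composing with [T] changes only two of the terms. *)
Lemma empirical_limit g (c : R) : continuous g ->
  (forall N, exists n x, [/\ (N <= n)%N, (0 < n)%N &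
     c * n%:R <= \sum_(i < n) g (iter i T x)]) ->
  exists2 L, invariant_state L & c <= L g.
Proof.
move=> cg /choice[n /choice[x nx]].
have n0 k : 0 < (n k)%:R :> R by rewrite ltr0n; case: (nx k).
pose E (k : nat) : V := fun f => if `[< continuous f >] then
  (n k)%:R^-1 * \sum_(i < n k) f (iter i T (x k)) else 0.
have EE k f : continuous f ->
    E k f = (n k)%:R^-1 * \sum_(i < n k) f (iter i T (x k)).
  by move=> cf; rewrite /E; case: asboolP.
have sumE f (k : nat) (m : R) : (forall x, f x <= m) ->
    \sum_(i < n k) f (iter i T (x k)) <= m * (n k)%:R.
  move=> fm; apply: (@le_trans _ _ (\sum_(i < n k) m)); first exact: ler_sum.
  by rewrite sumr_const card_ord mulr_natr.
have [b [fb b0 cb]] := state_box.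
have Eb k f : `|E k f| <= b f.
  rewrite /E; case: asboolP => cf; last by rewrite normr0.
  rewrite normrM gtr0_norm ?invr_gt0// ler_pdivrMl// mulrC.
  apply: le_trans (ler_norm_sum _ _ _) _.
  by apply: (sumE (fun x => `|f x|)) => y; exact: fb.
have [|L [Lb clL]] := cb (E @ \oo) _.
  by exists 0%N => // k _ /= f; exact: Eb.
have sub (A : set V) : closed A -> (\forall k \near \oo, A (E k)) -> A L.
  by move=> clA EA; apply: clA => B BL; have [M [AM BM]] := clL A B EA BL; exists M.
have ev := @ptws_eval_continuous R (X -> R).
exists L; last first.
  apply: (sub [set L : V | c <= L g]); first exact: closed_eval_ge.
  exists 0%N => // k _ /=; rewrite EE// ler_pdivlMl// mulrC.
  by case: (nx k).
have LT f : continuous f -> L (f \o T) = L f.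
  move=> cf; have cfT : continuous (f \o T) by exact: (@continuous_comp_iter f 1 cf).
  have telescope k : E k (f \o T) - E k f =
      (n k)%:R^-1 * (f (iter (n k) T (x k)) - f (x k)).
    rewrite !EE// -mulrBr -sumrB; congr (_ * _).
    by rewrite -(telescope_sumr (fun i => f (iter i T (x k))) (leq0n _)) big_mkord.
  have small e : 0 < e -> \forall k \near \oo, `|E k (f \o T) - E k f| <= e.
    move=> e0; near=> k; rewrite telescope normrM gtr0_norm ?invr_gt0//.
    rewrite ler_pdivrMl//; apply: (@le_trans _ _ (2 * b f)).
      rewrite (le_trans (ler_normB _ _))// mulr_natl mulr2n lerD//; exact: fb.
    rewrite -ler_pdivrMr//; apply: (@le_trans _ _ k%:R).
      by near: k; exact: nbhs_infty_ger.
    by rewrite ler_nat; case: (nx k).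
  apply/eqP; rewrite -subr_eq0 -normr_le0; apply/ler_addgt0Pl => e e0.
  rewrite addr0.
  apply: (sub [set L : V | `|L (f \o T) - L f| <= e]); last exact: small.
  apply: (@preimage_closed _ _ (fun L : V => `|L (f \o T) - L f|) [set r | r <= e]).
    have cE : continuous (fun M : V => M (f \o T) - M f).
      by move=> M; exact: (continuousB (ev (f \o T) M) (ev f M)).
    by move=> M _; exact: (continuous_comp (cE M) (@norm_continuous R R^o _)).
  exact: closed_le.
split => //; first split.
- move=> f h cf ch.
  apply: (sub [set L : V | L (fun x => f x + h x) = L f + L h]).
    by apply: closed_eval_eq => // M; exact: (continuousD (ev _ M) (ev _ M)).
  exists 0%N => // k _ /=; rewrite !EE//; last exact: continuous_addf.
  by rewrite big_split/= mulrDr.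
- move=> a f cf.
  apply: (sub [set L : V | L (fun x => a * f x) = a * L f]).
    by apply: closed_eval_eq => // M; exact: (continuousM (@cst_continuous _ _ a M) (ev f M)).
  exists 0%N => // k _ /=; rewrite !EE//; last exact: continuous_scalef.
  by rewrite -mulr_sumr mulrCA.
- move=> f cf f0; apply: (sub [set L : V | 0 <= L f]); first exact: closed_eval_ge.
  by exists 0%N => // k _ /=; rewrite EE// mulr_ge0// sumr_ge0.
- apply: (sub [set L : V | L (fun=> 1) = 1]).
    apply: closed_eval_eq => //; exact: cst_continuous.
  exists 0%N => // k _ /=; rewrite EE; last exact: continuous_cstf.
  by rewrite sumr_const card_ord mulVf// gt_eqF.
- move=> f ncf; apply: (sub [set L : V | L f = 0]).
    apply: closed_eval_eq => //; exact: cst_continuous.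
  by exists 0%N => // k _ /=; rewrite /E; case: asboolP.
Unshelve. all: by end_near. Qed.

End InvariantStates.

(** * Codebooks *)

Section Codebooks.
Context {R : realType} {X : pmetricType R}.
Variables (T : X -> X) (kappa : X -> X -> R) (lam : R).
Implicit Types (y z : nat -> X).

(** A finitely supported measure on sequences of points, of which only the first
    [n] terms matter when it is used at length [n]. *)
Definition codebook := seq (R * (nat -> X)).
Implicit Types s : codebook.

Definition is_codebook s :=
  all (fun p => 0 <= p.1) s /\ \sum_(p <- s) p.1 = 1.

Definition word_likelihood n y x := \prod_(k < n) kappa (iter k T x) (y k).

Definition likelihood n s x := \sum_(p <- s) p.1 * word_likelihood n p.2 x.

(** The Lagrangian dual of rate distortion: the infimum over [s] of the mean of
    [code_length n s] is the infimum over codes of the information plus the mean of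
    the cost [- ln kappa]. *)
Definition code_length n s x : R := - ln (likelihood n s x).

Definition splice m y z : nat -> X := fun k => if (k < m)%N then y k else z (k - m)%N.

Definition codebook_half s : codebook := [seq (p.1 / 2, p.2) | p <- s].

Definition codebook_mix s1 s2 := codebook_half (s1 ++ s2).

Definition codebook_prod m s1 s2 : codebook :=
  [seq (p.1 * q.1, splice m p.2 q.2) | p <- s1, q <- s2].

Definition codebook_dirac y : codebook := [:: (1, y)].

(* at length [0], every word has likelihood [1] *)
Fixpoint codebook_power n k s : codebook :=
  if k is k'.+1 then codebook_prod n s (codebook_power n k' s)
  else codebook_dirac (fun=> point).

Lemma ler_sum_codebook s (F G : (nat -> X) -> R) :
  all (fun p => 0 <= p.1) s -> (forall y, F y <= G y) ->
  \sum_(p <- s) p.1 * F p.2 <= \sum_(p <- s) p.1 * G p.2.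
Proof.
move=> + FG; elim: s => [|p s IH] /=; first by rewrite !big_nil.
by move=> /andP[p0 /IH h]; rewrite !big_cons lerD// ler_wpM2l.
Qed.

Lemma is_codebook_dirac y : is_codebook (codebook_dirac y).
Proof. by split; rewrite /= ?ler01// big_seq1. Qed.

Lemma is_codebook_mix s1 s2 : is_codebook s1 -> is_codebook s2 ->
  is_codebook (codebook_mix s1 s2).
Proof.
move=> [p1 m1] [p2 m2]; split.
  rewrite all_map (@eq_all _ _ (fun p => 0 <= p.1)) ?all_cat ?p1//.
  by move=> p /=; rewrite pmulr_lge0// invr_gt0.
rewrite big_map/= -big_distrl/= big_cat/= m1 m2; lra.
Qed.

Lemma likelihood_mix n s1 s2 x : likelihood n (codebook_mix s1 s2) x =
  (likelihood n s1 x + likelihood n s2 x) / 2.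
Proof.
rewrite /likelihood big_map -big_cat/= big_distrl/=.
by apply: eq_bigr => p _; rewrite mulrAC.
Qed.

Lemma is_codebook_prod m s1 s2 : is_codebook s1 -> is_codebook s2 ->
  is_codebook (codebook_prod m s1 s2).
Proof.
move=> [p1 m1] [p2 m2]; split.
  elim: s1 p1 {m1} => [//|p s1 IH] /= /andP[p0 /IH h].
  rewrite all_cat h andbT all_map; apply: sub_all p2 => q /=.
  exact: mulr_ge0.
by rewrite big_allpairs_dep/= -big_distrlr/= m1 m2 mulr1.
Qed.

Lemma word_likelihood_splice m n y z x :
  word_likelihood (m + n) (splice m y z) x =
  word_likelihood m y x * word_likelihood n z (iter m T x).
Proof.
rewrite /word_likelihood big_split_ord/=; congr (_ * _); apply: eq_bigr => k _.
  by rewrite /splice ltn_ord.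
by rewrite /splice ltnNge leq_addr/= addKn -iterD addnC.
Qed.

Lemma likelihood_prod m n s1 s2 x :
  likelihood (m + n) (codebook_prod m s1 s2) x =
  likelihood m s1 x * likelihood n s2 (iter m T x).
Proof.
rewrite /likelihood big_allpairs_dep/= big_distrlr/=.
apply: eq_bigr => p _; apply: eq_bigr => q _.
by rewrite word_likelihood_splice mulrACA.
Qed.

Lemma is_codebook_power n k s : is_codebook s ->
  is_codebook (codebook_power n k s).
Proof.
move=> cs; elim: k => [|k IH]; first exact: is_codebook_dirac.
exact: is_codebook_prod.
Qed.

Hypothesis kappa_ge : forall x x', expR (- lam) <= kappa x x'.
Hypothesis kappa_le1 : forall x x', kappa x x' <= 1.

Lemma word_likelihood_bounds n y x :
  expR (- (lam * n%:R)) <= word_likelihood n y x <= 1.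
Proof.
have k0 x1 x2 : 0 <= kappa x1 x2 by rewrite (le_trans (expR_ge0 _) (kappa_ge _ _)).
rewrite /word_likelihood; apply/andP; split; last first.
  by apply: prodr_ile1 => k _; rewrite k0 kappa_le1.
rewrite -mulNr expRM_natr -[X in _ ^+ X]card_ord -prodr_const.
by apply: ler_prod => k _; rewrite expR_ge0 kappa_ge.
Qed.

Lemma likelihood_bounds n s x : is_codebook s ->
  expR (- (lam * n%:R)) <= likelihood n s x <= 1.
Proof.
move=> [p1 m1]; rewrite /likelihood; apply/andP; split.
- rewrite -[leLHS]mul1r -[X in X * _]m1 big_distrl/=.
  apply: (@ler_sum_codebook s (fun=> expR (- (lam * n%:R)))
    (fun y => word_likelihood n y x)) => // y.
  by have /andP[] := word_likelihood_bounds n y x.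
- rewrite -[leRHS]m1; under [leRHS]eq_bigr do rewrite -[_.1]mulr1.
  apply: (@ler_sum_codebook s (fun y => word_likelihood n y x) (fun=> 1)) => // y.
  by have /andP[] := word_likelihood_bounds n y x.
Qed.

Lemma likelihood_gt0 n s x : is_codebook s -> 0 < likelihood n s x.
Proof.
move=> /(likelihood_bounds n x)/andP[+ _]; apply: lt_le_trans.
exact: expR_gt0.
Qed.

Lemma code_length_bounds n s x : is_codebook s ->
  0 <= code_length n s x <= lam * n%:R.
Proof.
move=> cs; have l0 := likelihood_gt0 n x cs.
have /andP[l1 l2] := likelihood_bounds n x cs.
rewrite /code_length oppr_ge0 ln_le0//= lerNl -[leLHS]expRK.
by rewrite ler_ln ?posrE ?expR_gt0.
Qed.

Lemma expR_code_length n s x : is_codebook s ->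
  expR (- code_length n s x) = likelihood n s x.
Proof. by move=> cs; rewrite opprK lnK// posrE likelihood_gt0. Qed.

Lemma code_length_mix n s1 s2 x : is_codebook s1 -> is_codebook s2 ->
  code_length n (codebook_mix s1 s2) x <= code_length n s1 x + ln 2 /\
  code_length n (codebook_mix s1 s2) x <= code_length n s2 x + ln 2.
Proof.
move=> cs1 cs2; have l1 := likelihood_gt0 n x cs1.
have l2 := likelihood_gt0 n x cs2.
have key (a b : R) : 0 < a -> 0 < b -> - ln ((a + b) / 2) <= - ln a + ln 2.
  move=> a0 b0; rewrite lerNl opprD opprK -ln_div ?posrE//.
  by rewrite ler_ln ?posrE ?divr_gt0 ?addr_gt0// ler_pM2r ?invr_gt0// lerDl ltW.
rewrite /code_length likelihood_mix; split; first exact: key.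
by rewrite addrC key.
Qed.

Lemma code_length_prod m n s1 s2 x : is_codebook s1 -> is_codebook s2 ->
  code_length (m + n) (codebook_prod m s1 s2) x =
  code_length m s1 x + code_length n s2 (iter m T x).
Proof.
move=> cs1 cs2; rewrite /code_length likelihood_prod lnM ?opprD//.
  by rewrite posrE likelihood_gt0.
by rewrite posrE likelihood_gt0.
Qed.

Lemma code_length_power n k s x : is_codebook s ->
  code_length (k * n) (codebook_power n k s) x =
  \sum_(i < k) code_length n s (iter (i * n) T x).
Proof.
move=> cs; elim: k x => [|k IH] x.
  rewrite mul0n big_ord0 /code_length /likelihood big_seq1/=.
  by rewrite /word_likelihood big_ord0 mulr1 ln1 oppr0.
rewrite mulSn code_length_prod//; last exact: is_codebook_power.
rewrite big_ord_recl/= IH; congr (_ + _); apply: eq_bigr => i _.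
by rewrite -iterD /bump/= mulnDl mul1n addnC.
Qed.

Hypothesis contT : continuous T.
Hypothesis kappa_continuous : forall x', continuous (fun x => kappa x x').

Lemma continuous_word_likelihood n y : continuous (word_likelihood n y).
Proof.
apply: continuous_prodf => k.
apply: (@continuous_comp_iter _ _ T contT (fun x => kappa x (y k)) k).
exact: kappa_continuous.
Qed.

Lemma continuous_code_length n s : is_codebook s -> continuous (code_length n s).
Proof.
move=> cs x; apply: cvgN.
apply: (@cvg_comp _ _ _ (likelihood n s) (@ln R)); last first.
  by apply: continuous_ln; exact: likelihood_gt0.
apply: (continuous_sumf (F := fun p x => p.1 * word_likelihood n p.2 x)) => p.
by apply: continuous_scalef; exact: continuous_word_likelihood.
Qed.

Lemma state_code_length_power L n k s : invariant_state T L -> is_codebook s ->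
  L (code_length (k * n) (codebook_power n k s)) = k%:R * L (code_length n s).
Proof.
move=> [sL LT _] cs.
have LTi f i : continuous f -> L (fun x => f (iter i T x)) = L f.
  move=> cf; elim: i => [//|i IH]; rewrite -[RHS]IH -[RHS]LT//; last exact: continuous_comp_iter.
  by congr L; apply/funext => x /=; rewrite -iterSr.
have cc := @continuous_code_length n s cs.
have -> : code_length (k * n) (codebook_power n k s) =
    (fun x => \sum_(i < k) code_length n s (iter (i * n) T x)).
  by apply/funext => x; rewrite code_length_power.
rewrite (state_sum sL) => [|i]; last exact: continuous_comp_iter.
by under eq_bigr do rewrite LTi//; rewrite sumr_const card_ord mulr_natl.
Qed.

End Codebooks.

(** * Codebooks and separated sets *)

Section EDivision.
Context {R : realType}.

Lemma lee_div_fin (x : \bar R) (a r : R) : 0 < r ->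
  (x / r%:E <= a%:E)%E = (x <= (a * r)%:E)%E.
Proof. by move=> r0; rewrite inver gt_eqF// lee_pdivrMr// EFinM. Qed.

Lemma lee_fin_div (x : \bar R) (a r : R) : 0 < r ->
  (a%:E <= x / r%:E)%E = ((a * r)%:E <= x)%E.
Proof. by move=> r0; rewrite inver gt_eqF// lee_pdivlMr// EFinM. Qed.

End EDivision.

Section BowenMetric.
Context {R : realType} {X : pmetricType R}.
Variable T : X -> X.

Lemma bowen_distP n (x y : X) e : 0 < e ->
  reflect (forall k, (k < n)%N -> mdist (iter k T x) (iter k T y) < e)
          (bowen_dist T n x y < e).
Proof.
move=> e0; apply: (iffP idP) => [xy k kn|xy].
  apply: le_lt_trans xy.
  exact: (@le_bigmax _ _ _ _ (fun j : 'I_n => mdist (iter j T x) (iter j T y))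
    (Ordinal kn)).
by apply/bigmax_ltP; split => // k _; exact: xy.
Qed.

Definition separated n (e : R) (S : {fset X}) := forall x x' : X,
  x \in S -> x' \in S -> x != x' -> e <= bowen_dist T n x x'.

(** A separated set of maximal size is spanning. *)
Lemma separated_spanning n e (m : nat) :
  (forall S, separated n e S -> (#|` S| <= m)%N) -> 0 < e ->
  exists S, separated n e S /\ spanning T n e S.
Proof.
move=> bounded e0.
pose P k := `[< exists2 S, separated n e S & #|` S| = k >].
have P0 : exists k, P k.
  by exists 0%N; apply/asboolP; exists fset0 => //; rewrite cardfs0.
have Pm k : P k -> (k <= m)%N by move=> /asboolP[S /bounded + <-].
case: (ex_maxnP P0 Pm) => k /asboolP[S sepS <-] maxS.
exists S; split=> // x; apply: contrapT => far.
have xS : x \notin S.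
  apply/negP => xS; apply: far; exists x => //.
  by apply/bowen_distP => // j _; rewrite mdistxx.
have {}far y : y \in S -> e <= bowen_dist T n x y.
  by move=> yS; rewrite leNgt; apply/negP => xy; apply: far; exists y.
have bowen_sym y z : bowen_dist T n y z = bowen_dist T n z y.
  by rewrite /bowen_dist; apply: eq_bigr => j _; rewrite metric_sym.
suff /maxS : P #|` x |` S|%fset by rewrite cardfsU1 xS add1n ltnn.
apply/asboolP; exists (x |` S)%fset => //.
move=> y z; rewrite !in_fset1U => /orP[/eqP->|yS] /orP[/eqP->|zS] yz.
- by rewrite eqxx in yz.
- exact: far.
- by rewrite bowen_sym far.
- exact: sepS.
Qed.

End BowenMetric.

Section Counting.
Context {R : realType} {X : pmetricType R}.
Variables (T : X -> X) (kappa : X -> X -> R) (lam : R).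
Hypothesis kappa_ge : forall x x', expR (- lam) <= kappa x x'.
Hypothesis kappa_le1 : forall x x', kappa x x' <= 1.
Variables (r : R) (M : nat) (cell : X -> 'I_M).
Hypothesis cell_small : forall x x', cell x = cell x' -> mdist x x' < 2 * r.
Hypothesis kappa_far : forall x x', r <= mdist x x' -> kappa x x' <= expR (- lam).

Let r_gt0 : 0 < r.
Proof.
have := cell_small (erefl (cell point)).
by rewrite mdistxx pmulr_rgt0.
Qed.

(** [None] stands for the times when the orbit follows [y].  If two points have the
    same itinerary then their orbits are close at all times, both being close to
    [y] or both in the same cell, so that itineraries tell the points of a
    separated set apart. *)
Let itinerary n (y : nat -> X) (x : X) : {ffun 'I_n -> option 'I_M} :=
  [ffun k : 'I_n => if mdist (iter k T x) (y k) < r then None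
                    else Some (cell (iter k T x))].

(** The right side is the sum over all itineraries of the products of [1] for each
    [None] and of [expR (- lam)] for each cell. *)
Lemma sum_separated_word n y (S : {fset X}) : separated T n (2 * r) S ->
  \sum_(x <- S) word_likelihood T kappa n y x
    <= (1 + M%:R * expR (- lam)) ^+ n.
Proof.
move=> sepS.
pose v (a : option 'I_M) : R := if a is Some _ then expR (- lam) else 1.
have v0 a : 0 <= v a by case: a => [a|] /=; rewrite ?expR_ge0.
have k0 x x' : 0 <= kappa x x' by rewrite (le_trans (expR_ge0 _) (kappa_ge _ _)).
have sumv : \sum_a v a = 1 + M%:R * expR (- lam).
  rewrite (bigD1 None)//= (reindex_omap Some id)/=; last by case.
  congr (_ + _); rewrite (eq_bigl xpredT) => [|i]; last by rewrite eqxx.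
  by rewrite sumr_const card_ord mulr_natl.
have -> : (1 + M%:R * expR (- lam)) ^+ n =
    \sum_(u : {ffun 'I_n -> option 'I_M}) \prod_(k < n) v (u k).
  rewrite -(bigA_distr_bigA (fun (_ : 'I_n) a => v a)).
  by rewrite prodr_const card_ord sumv.
have injS : {in S &, injective (itinerary n y)}.
  move=> x x' xS x'S /ffunP eqI; apply/eqP; apply: contraT => xx'.
  have := sepS x x' xS x'S xx'; rewrite leNgt => /negP; case.
  apply/bowen_distP; first by rewrite mulr_gt0.
  move=> k kn; have := eqI (Ordinal kn); rewrite !ffunE/=.
  case: ifPn => xy; case: ifPn => x'y //; last by move=> [/cell_small].
  move=> _.
  rewrite (le_lt_trans (metric_triangle _ (y k) _))// mulr2n mulrDl mul1r.
  by rewrite ltrD// metric_sym.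
apply: (@le_trans _ _ (\sum_(u <- [seq itinerary n y x | x <- S])
    \prod_(k < n) v (u k))).
  rewrite big_map; apply: ler_sum => x _; apply: ler_prod => k _.
  rewrite k0/= ffunE; case: ifPn => //=; rewrite -leNgt; exact: kappa_far.
rewrite big_uniq/=; last by rewrite map_inj_in_uniq ?fset_uniq.
rewrite [leRHS](bigID (mem [seq itinerary n y x | x <- S]))/= lerDl.
by apply: sumr_ge0 => u _; exact: prodr_ge0.
Qed.

Lemma sum_separated_likelihood n s (S : {fset X}) : separated T n (2 * r) S ->
  is_codebook s -> \sum_(x <- S) likelihood T kappa n s x
    <= (1 + M%:R * expR (- lam)) ^+ n.
Proof.
move=> sepS [p1 m1]; rewrite exchange_big/= -[leRHS]mul1r -[X in X * _]m1.
rewrite big_distrl/=; under eq_bigr do rewrite -mulr_sumr.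
apply: (@ler_sum_codebook _ _ s
  (fun y => \sum_(x <- S) word_likelihood T kappa n y x)
  (fun=> (1 + M%:R * expR (- lam)) ^+ n)) => // y.
exact: sum_separated_word.
Qed.

Lemma card_separated_le n (S : {fset X}) (c : R) (ss : seq (codebook (X := X))) :
  separated T n (2 * r) S -> (forall s, List.In s ss -> is_codebook s) ->
  (forall x, c <= \sum_(s <- ss) likelihood T kappa n s x) ->
  #|` S|%:R * c <= (size ss)%:R * (1 + M%:R * expR (- lam)) ^+ n.
Proof.
move=> sepS css cle.
apply: (@le_trans _ _ (\sum_(x <- S) \sum_(s <- ss) likelihood T kappa n s x)).
  rewrite mulr_natl -iter_addr_0 -count_predT -big_const_seq.
  by apply: ler_sum => x _; exact: cle.
rewrite exchange_big/=; elim: ss css {cle} => [|s ss IH] css.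
  by rewrite big_nil mul0r.
rewrite big_cons/= -natr1 mulrDl mul1r addrC lerD//.
  by apply: IH => s' ss'; apply: css; right.
by apply: sum_separated_likelihood => //; apply: css; left.
Qed.

Lemma exists_separated_spanning n :
  exists S, separated T n (2 * r) S /\ spanning T n (2 * r) S.
Proof.
pose B := (1 + M%:R * expR (- lam)) ^+ n / expR (- (lam * n%:R)).
apply: (@separated_spanning _ _ T n (2 * r) (Num.bound B)); last by rewrite mulr_gt0.
move=> S sepS; rewrite -(ler_nat R) ltW// (le_lt_trans _ (archi_boundP _))//.
- rewrite ler_pdivlMr ?expR_gt0//.
  have := @card_separated_le n S (expR (- (lam * n%:R)))
    [:: codebook_dirac (fun=> point)] sepS.
  rewrite mul1r; apply => [s [<-|//]|x]; first exact: is_codebook_dirac.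
  rewrite big_seq1; have := likelihood_bounds T kappa_ge kappa_le1 n x
    (is_codebook_dirac (fun=> point)).
  by case/andP.
- rewrite divr_ge0 ?expR_ge0// exprn_ge0// addr_ge0// mulr_ge0// expR_ge0//.
Qed.

End Counting.

Section Concatenation.
Context {R : realType} {X : pmetricType R}.
Variables (T : X -> X) (kappa : X -> X -> R) (lam : R).
Hypothesis compactX : compact [set: X].
Hypothesis contT : continuous T.
Hypothesis kappa_continuous : forall x', continuous (fun x => kappa x x').
Hypothesis kappa_ge : forall x x', expR (- lam) <= kappa x x'.
Hypothesis kappa_le1 : forall x x', kappa x x' <= 1.
Variables (r : R) (M : nat) (cell : X -> 'I_M).
Hypothesis cell_small : forall x x', cell x = cell x' -> mdist x x' < 2 * r.
Hypothesis kappa_far : forall x x', r <= mdist x x' -> kappa x x' <= expR (- lam).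
Hypothesis M_lam : M%:R * expR (- lam) <= 1.
Implicit Types s : codebook (X := X).

Lemma sum_residues (f : nat -> R) N k :
  \sum_(j < N) \sum_(i < k) f (i * N + j)%N = \sum_(m < k * N) f m.
Proof.
elim: k => [|k IH].
  by rewrite mul0n big_ord0 big1// => j _; rewrite big_ord0.
under eq_bigr do rewrite big_ord_recr/=.
rewrite big_split/= IH [in RHS](_ : k.+1 * N = k * N + N)%N ?big_split_ord//.
by rewrite mulSn addnC.
Qed.

(* the repeated code with offset [j], followed by [N - j] letters that are free *)
Let padded s N k j : codebook (X := X) :=
  codebook_prod j (codebook_dirac (fun=> point))
    (codebook_prod (k * N) (codebook_power N k s) (codebook_dirac (fun=> point))).

Let likelihood_padded s N k j x : is_codebook s -> (j <= N)%N ->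
  expR (- (lam * N%:R + \sum_(i < k) code_length T kappa N s (iter (i * N + j) T x)))
    <= likelihood T kappa (k * N + N) (padded s N k j) x.
Proof.
move=> cs jN; have lb := likelihood_bounds T kappa_ge kappa_le1.
have cd := is_codebook_dirac (fun=> point : X).
have -> : (k * N + N = j + (k * N + (N - j)))%N.
  by rewrite addnCA subnKC.
rewrite !likelihood_prod -(expR_code_length T kappa_ge kappa_le1 (k * N)); last first.
  exact: is_codebook_power.
rewrite (code_length_power T kappa_ge kappa_le1)//.
have -> : lam * N%:R = lam * j%:R + lam * (N - j)%:R.
  by rewrite -mulrDr -natrD subnKC.
rewrite !opprD expRD expRD -mulrA [X in _ * X]mulrC.
have /andP[l1 _] := lb j _ x cd.
have /andP[l2 _] := lb (N - j)%N _ (iter (k * N) T (iter j T x)) cd.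
apply: ler_pM; rewrite ?expR_ge0 ?mulr_ge0 ?expR_ge0//.
apply: ler_pM; rewrite ?expR_ge0//.
by under eq_bigr do rewrite iterD.
Qed.

(** For each starting point one of the [N] alignments of the repeated code is at
    least as good as the orbit average, hence has a likelihood of at least
    [expR (- n * h)] up to a constant; and the likelihoods of a separated set have a
    bounded sum. *)
Lemma spanning_number_le s N (h : R) k : (0 < N)%N -> is_codebook s ->
  (forall x, \sum_(m < k * N) code_length T kappa N s (iter m T x)
     <= N%:R * h * (k * N)%:R) ->
  (lne (spanning_number T (k * N + N) (2 * r)) <=
    (ln N%:R + lam * N%:R + N%:R * ln 2 + (k * N)%:R * (h + ln 2))%:E)%E.
Proof.
move=> N0 cs avg.
have [S [sepS spanS]] := exists_separated_spanning T kappa_ge kappa_le1 cell_small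
  kappa_far (k * N + N).
have S0 : (0 < #|` S|)%N.
  have [y yS _] := spanS point; rewrite lt0n cardfs_eq0; apply/eqP => S0.
  by rewrite S0 in_fset0 in yS.
have N0R : 0 < N%:R :> R by rewrite ltr0n.
have := @card_separated_le R X T kappa lam kappa_ge kappa_le1 r M cell cell_small kappa_far
  (k * N + N) S (expR (- (lam * N%:R + (k * N)%:R * h)))
  [seq padded s N k j | j <- iota 0 N] sepS.
rewrite size_map size_iota => card_le.
have {}card_le : #|` S|%:R <=
    N%:R * 2 ^+ (k * N + N) * expR (lam * N%:R + (k * N)%:R * h).
  rewrite -ler_pdivrMr ?expR_gt0// -expRN; apply: le_trans (card_le _ _) _.
  - move=> q; elim: (iota 0 N) => //= j js IH [<-|/IH//].
    apply: is_codebook_prod; first exact: is_codebook_dirac.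
    by apply: is_codebook_prod; [exact: is_codebook_power|exact: is_codebook_dirac].
  - move=> x; rewrite big_map -[in iota 0 N](subn0 N) -/(index_iota 0 N) big_mkord.
    (* the average over the offsets is at most [(k * N)%:R * h] *)
    have [j jle] : exists j : 'I_N,
        \sum_(i < k) code_length T kappa N s (iter (i * N + j) T x) <= (k * N)%:R * h.
      apply: contrapT => /forallNP no.
      have := avg x; rewrite -(sum_residues (fun m => code_length T kappa N s
        (iter m T x))) leNgt => /negP; apply.
      rewrite -mulrA [h * _]mulrC -[X in X%:R * _]card_ord mulr_natl -sumr_const.
      apply: ltr_sum => [|j _]; last by rewrite ltNge; apply/negP; exact: no.
      by apply/hasP; exists (Ordinal N0) => //; exact: mem_index_enum.
    rewrite (bigD1 j)//= ler_wpDr//.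
      apply: sumr_ge0 => i _; apply/ltW/(likelihood_gt0 T kappa_ge kappa_le1).
      apply: is_codebook_prod; first exact: is_codebook_dirac.
      by apply: is_codebook_prod; [exact: is_codebook_power|exact: is_codebook_dirac].
    apply: le_trans (likelihood_padded _ _ cs (ltnW (ltn_ord j))).
    by rewrite ler_expR lerN2 lerD2l.
  - rewrite ler_wpM2l// lerXn2r// ?nnegrE ?addr_ge0 ?mulr_ge0 ?expR_ge0//.
    by move: M_lam; lra.
apply: (@le_trans _ _ (lne (#|` S|%:R)%:E)).
  have n0 : (0 <= spanning_number T (k * N + N) (2 * r))%E.
    by apply: le_ereal_inf_tmp => _ [E _ <-]; rewrite lee_fin.
  rewrite lee_lne ?in_itv/= ?n0 ?leey ?lee_fin ?andbT//.
  by apply: ereal_inf_lbound; exists S.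
rewrite lne_EFin ?ltr0n// lee_fin.
move: card_le; rewrite -ler_ln ?posrE ?mulr_gt0 ?exprn_gt0 ?expR_gt0 ?ltr0n//.
rewrite !lnM ?posrE ?mulr_gt0 ?exprn_gt0 ?expR_gt0// expRK lnXn// -[ln 2 *+ _]mulr_natl natrD.
lra.
Qed.

Lemma spanning_number_nondecreasing m n e : (m <= n)%N -> 0 < e ->
  (spanning_number T m e <= spanning_number T n e)%E.
Proof.
move=> mn e0; apply: le_ereal_inf => _ [E spanE <-]; exists E => //= x.
have [y yE xy] := spanE x; exists y => //; apply/bowen_distP => // k km.
by move/(bowen_distP _ _ _ _ e0) : xy; apply; exact: leq_trans mn.
Qed.

Lemma spanning_rate_le s N (h : R) : (0 < N)%N -> is_codebook s -> 0 <= h ->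
  (forall L, invariant_state T L -> L (code_length T kappa N s) < N%:R * h) ->
  (spanning_rate T (2 * r) <= (h + ln 2)%:E)%E.
Proof.
move=> N0 cs h0 Lh.
have cc : continuous (code_length T kappa N s).
  by apply: (@continuous_code_length _ _ _ _ lam).
have r0 : 0 < 2 * r by rewrite -(mdistxx (point : X)) cell_small.
have [n0 avg] : exists n0, forall n x, (n0 <= n)%N -> (0 < n)%N ->
    \sum_(m < n) code_length T kappa N s (iter m T x) <= N%:R * h * n%:R.
  apply: contrapT => /forallNP long.
  have [n0|L iL hL] := empirical_limit compactX contT (c := N%:R * h) cc.
    have /existsNP[n /existsNP[x]] := long n0.
    move=> /not_implyP[n0n /not_implyP[n_gt0 /negP]]; rewrite -ltNge => /ltW le.
    by exists n, x.
  by have := Lh L iL; rewrite ltNge hL.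
pose C := ln N%:R + lam * N%:R + N%:R * ln 2.
have rate_le n : (n0 + N + 1 <= n)%N ->
    (lne (spanning_number T n (2 * r)) / (n%:R)%:E <= ((h + ln 2) + C / n%:R)%:E)%E.
  move=> n0n; have n_gt0 : (0 < n)%N by apply: leq_trans n0n; rewrite addn1.
  rewrite lee_div_fin ?ltr0n//.
  have kN : (n %/ N * N <= n)%N by exact: leq_trunc_div.
  have kN' : (n < n %/ N * N + N)%N by rewrite addnC -mulSn ltn_ceil.
  have nkN : (n0 < n %/ N * N)%N.
    rewrite -(ltn_add2r N); apply: leq_ltn_trans kN'.
    by apply: leq_trans n0n; exact: leq_addr.
  apply: (@le_trans _ _ (lne (spanning_number T (n %/ N * N + N) (2 * r)))).
    have ge0 m : (0 <= spanning_number T m (2 * r))%E.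
      by apply: le_ereal_inf_tmp => _ [E _ <-]; rewrite lee_fin.
    rewrite lee_lne ?in_itv/= ?ge0 ?leey//.
    by apply: spanning_number_nondecreasing; [exact: ltnW|].
  apply: le_trans (spanning_number_le (h := h) N0 cs _) _ => [x|].
    by apply: avg; [exact: ltnW|exact: leq_ltn_trans nkN].
  rewrite lee_fin -/C mulrDl divfK ?gt_eqF ?ltr0n// addrC lerD2r mulrC.
  by rewrite ler_wpM2l ?addr_ge0 ?ln_ge0 ?ler1n// ler_nat.
apply/lee_addgt0Pr => e e0; rewrite -EFinD.
rewrite /spanning_rate /limn_esup limf_esupE.
have [n1 n1P] : exists n1, forall n, (n1 <= n)%N -> C / n%:R <= e.
  exists (Num.bound (`|C| / e)).+1 => n n1n.
  have n_gt0 : 0 < n%:R :> R by rewrite ltr0n; exact: leq_trans n1n.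
  rewrite ler_pdivrMr// mulrC -ler_pdivrMr//.
  apply: (@le_trans _ _ (`|C| / e)); first by rewrite ler_pM2r ?invr_gt0// ler_norm.
  apply: (le_trans (ltW (archi_boundP _))); first by rewrite divr_ge0// ltW.
  by rewrite ler_nat; exact: ltnW.
pose tail := [set n | (n0 + N + 1 + n1 <= n)%N].
apply: (@le_trans _ _ (ereal_sup
    [set (lne (spanning_number T n (2 * r)) / (n%:R)%:E)%E | n in tail])).
  apply: ereal_inf_lbound; exists tail => //; exists (n0 + N + 1 + n1)%N => //.
apply: ge_ereal_sup => _ [n /= nn <-].
apply: (le_trans (rate_le n _)); first exact: leq_trans (leq_addr _ _) nn.
rewrite lee_fin lerD2l; apply: n1P; exact: leq_trans (leq_addl _ _) nn.
Qed.

End Concatenation.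

(** * An ergodic measure with long codes *)

Lemma mnormalizeE d (Y : measurableType d) (R : realType)
    (m : {measure set Y -> \bar R}) (P : probability Y R) (r : R) B : 0 < r ->
  m setT = r%:E -> mnormalize m P B = (m B * (r^-1)%:E)%E.
Proof. by move=> r0; rewrite /mnormalize => ->; rewrite /= eqe gt_eqF. Qed.

Section Ergodicity.
Context {R : realType} {X : pmetricType R}.
Variable T : X -> X.
Hypothesis compactX : compact [set: X].
Hypothesis contT : continuous T.
Implicit Types (mu nu : probability (borel X) R) (f : X -> R).

Lemma borel_measurable_map : measurable_fun [set: borel X] (T : borel X -> borel X).
Proof.
apply: (@measurability _ _ (borel X) (borel X) setT T (@open X)) => //.
move=> _ [U oU <-]; rewrite setTI; apply: sub_sigma_algebra.
by move/continuousP : contT; apply.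
Qed.

Definition borel_map : {mfun borel X >-> borel X} :=
  HB.pack (T : borel X -> borel X)
    (isMeasurableFun.Build _ _ (borel X) (borel X) T borel_measurable_map).

Lemma expected_value_distribution mu f : continuous f ->
  expected_value (distribution mu (borel_map : {RV mu >-> borel X})) f =
  expected_value mu (f \o T).
Proof.
move=> cf; rewrite /expected_value /Rintegral; congr fine.
rewrite integral_distribution//.
  by apply/measurable_EFinP; exact: continuous_borel_measurable.
rewrite [X in _.-integrable _ X](_ : _ = EFin \o (f \o T))//.
apply: continuous_integrable => //.
exact: (@continuous_comp_iter _ _ T contT f 1).
Qed.

Lemma invariant_measureP mu :
  (forall f, continuous f -> expected_value mu (f \o T) = expected_value mu f) <->
  invariant_measures T mu.
Proof.
split=> [inv A mA|inv f cf].
  apply: (@eq_measure_expected_value _ _ compactX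
    (distribution mu (borel_map : {RV mu >-> borel X})) mu _ A mA) => f cf.
  by rewrite expected_value_distribution// inv.
rewrite -expected_value_distribution// /expected_value /Rintegral; congr fine.
by apply: eq_measure_integral => A mA _; exact: inv.
Qed.

(** The values at discontinuous functions are cut off so that [functional_of]
    lands in a compact set. *)
Definition functional_of mu : {ptws (X -> R) -> R} := fun f =>
  if `[< continuous f >] then expected_value mu f else 0.

Lemma functional_ofE mu f : continuous f -> functional_of mu f = expected_value mu f.
Proof. by move=> cf; rewrite /functional_of; case: asboolP. Qed.

Lemma invariant_state_functional_of mu : invariant_measures T mu ->
  invariant_state T (functional_of mu).
Proof.
move=> inv; have sE := state_expected_value compactX mu.
have cfT f : continuous f -> continuous (f \o T).
  exact: (@continuous_comp_iter _ _ T contT f 1).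
split; first split.
- move=> f g cf cg; rewrite !functional_ofE//; first exact: stateD.
  exact: continuous_addf.
- move=> a f cf; rewrite !functional_ofE//; first exact: stateZ.
  exact: continuous_scalef.
- by move=> f cf f0; rewrite functional_ofE//; exact: (state_ge0 sE).
- by rewrite functional_ofE; [exact: state1|exact: continuous_cstf].
- move=> f cf; rewrite !functional_ofE//; last exact: cfT.
  by move/invariant_measureP : inv; apply.
- by move=> f ncf; rewrite /functional_of; case: asboolP.
Qed.

(** The decomposition of an invariant measure along an invariant set of
    intermediate measure is a nontrivial mixture of invariant measures. *)
Lemma extreme_ergodic mu : invariant_measures T mu ->
  (forall t L1 L2, 0 < t < 1 -> invariant_state T L1 -> invariant_state T L2 ->
     functional_of mu = mixture t L1 L2 -> L1 = functional_of mu) ->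
  ergodic_measures T mu.
Proof.
move=> inv ext; split=> // A mA TA; apply: contrapT => /not_orP[muA0 muA1].
have fin B : measurable B -> mu B \is a fin_num by move=> mB; exact: fin_num_measure.
pose p := fine (mu A).
have muA : mu A = p%:E by rewrite fineK// fin.
have p01 : 0 < p < 1.
  rewrite -!lte_fin -muA !lt_neqAle measure_ge0 probability_le1// !andbT.
  by apply/andP; split; apply/eqP => // h; apply: muA0.
have /andP[p0 p1] := p01.
have mAc : measurable (~` A) by exact: measurableC.
have muAc : mu (~` A) = (1 - p)%:E by rewrite probability_setC// muA.
pose mu1 : probability (borel X) R := mnormalize (mrestr mu mA) mu.
pose mu2 : probability (borel X) R := mnormalize (mrestr mu mAc) mu.
have mu1E B : mu1 B = (mu (B `&` A) * (p^-1)%:E)%E.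
  apply: (@mnormalizeE _ _ _ (mrestr mu mA) mu p B p0).
  by rewrite /= /mrestr setTI.
have mu2E B : mu2 B = (mu (B `&` ~` A) * ((1 - p)^-1)%:E)%E.
  apply: (@mnormalizeE _ _ _ (mrestr mu mAc) mu (1 - p) B); first by rewrite subr_gt0.
  by rewrite /= /mrestr setTI.
have inv1 : invariant_measures T mu1.
  move=> B mB; rewrite [LHS]mu1E [RHS]mu1E; congr (_ * _)%E.
  by rewrite -[in LHS]TA -preimage_setI inv//; exact: measurableI.
have inv2 : invariant_measures T mu2.
  move=> B mB; rewrite [LHS]mu2E [RHS]mu2E; congr (_ * _)%E.
  rewrite -[in LHS]TA preimage_setC -preimage_setI inv//; exact: measurableI.
have p'0 : 0 < 1 - p by rewrite subr_gt0.
pose m : {measure set (borel X) -> \bar R} :=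
  measure_add (mscale (NngNum (ltW p0)) mu1) (mscale (NngNum (ltW p'0)) mu2).
have mE B : measurable B -> m B = mu B.
  move=> mB.
  have -> : m B = (p%:E * mu1 B + (1 - p)%:E * mu2 B)%E by exact: measure_addE.
  rewrite mu1E mu2E.
  rewrite muleCA -EFinM divff ?gt_eqF// mule1.
  rewrite muleCA -EFinM divff ?gt_eqF// mule1.
  by rewrite -setDE addeC -measureDI.
have mixE f : continuous f -> (forall x, 0 <= f x) ->
    expected_value mu f = p * expected_value mu1 f + (1 - p) * expected_value mu2 f.
  move=> cf f0; rewrite /expected_value /Rintegral.
  rewrite (eq_measure_integral m) => [|B mB _]; last by rewrite mE.
  have mf : measurable_fun setT (EFin \o (f : borel X -> R)).
    by apply/measurable_EFinP; exact: continuous_borel_measurable.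
  rewrite ge0_integral_measure_add//=; last by move=> x _; rewrite lee_fin.
  rewrite !ge0_integral_mscale//=; try by move=> x _; rewrite lee_fin.
  have fi nu : (\int[nu]_x (f x)%:E)%E \is a fin_num.
    by apply: integrable_fin_num => //; exact: continuous_integrable.
  by rewrite fineD ?fineM ?fin_numM ?fi.
have L1E : functional_of mu1 = functional_of mu.
  apply: (ext p _ (functional_of mu2)) => //; try exact: invariant_state_functional_of.
  apply/funext => f; rewrite /mixture /functional_of; case: asboolP => cf; last first.
    by rewrite !mulr0 addr0.
  have [b fb] := compact_continuous_bounded compactX cf.
  have cb : continuous (fun _ : X => b) by exact: continuous_cstf.
  have := mixE (fun x => f x + b) (continuous_addf cf cb).
  rewrite !(stateD (state_expected_value compactX _))//.
  rewrite !(state_cst (state_expected_value compactX _)).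
  move=> h; have {h} : expected_value mu f + b =
      p * (expected_value mu1 f + b) + (1 - p) * (expected_value mu2 f + b).
    by apply: h => x; have := fb x; rewrite ler_norml => /andP[]; lra.
  lra.
have := @eq_measure_expected_value _ _ compactX mu1 mu _ A mA.
rewrite mu1E setIid muA -EFinM divff ?gt_eqF// => h.
have : 1 = p.
  apply: EFin_inj; apply: h => f cf.
  by have := congr1 (fun L => L f) L1E; rewrite !functional_ofE.
by move=> p1'; rewrite -p1' ltxx in p1.
Qed.

End Ergodicity.

Section LongCodes.
Context {R : realType} {X : pmetricType R}.
Variables (T : X -> X) (kappa : X -> X -> R) (lam : R).
Hypothesis compactX : compact [set: X].
Hypothesis contT : continuous T.
Hypothesis kappa_continuous : forall x', continuous (fun x => kappa x x').
Hypothesis kappa_ge : forall x x', expR (- lam) <= kappa x x'.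
Hypothesis kappa_le1 : forall x x', kappa x x' <= 1.
Local Notation V := {ptws (X -> R) -> R}.
Implicit Types (s : codebook (X := X)) (L : V).

Let K : set V := [set L | invariant_state T L].

Definition code_rate L N s := L (code_length T kappa N s) / N%:R.

Let continuous_code N s : is_codebook s -> continuous (code_length T kappa N s).
Proof. by apply: (@continuous_code_length _ _ _ _ lam). Qed.

Let code_rate_bounds L N s : K L -> (0 < N)%N -> is_codebook s ->
  0 <= code_rate L N s <= lam.
Proof.
move=> [sL _ _] N0 cs; rewrite divr_ge0 ?ler0n//=.
  rewrite ler_pdivrMr ?ltr0n// -(state_cst sL (lam * _)).
  apply: (le_state sL) => [||x]; first exact: continuous_code.
    exact: continuous_cstf.
  by have /andP[] := code_length_bounds T kappa_ge kappa_le1 N x cs.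
apply: (state_ge0 sL) => [|x]; first exact: continuous_code.
by have /andP[] := code_length_bounds T kappa_ge kappa_le1 N x cs.
Qed.

Let rate_le_of_length L N s n s' e : K L -> is_codebook s -> is_codebook s' ->
  (0 < n)%N -> (0 < N)%N -> forall k, (N = k * n)%N ->
  (forall x, code_length T kappa N s x <=
     code_length T kappa (k * n) (codebook_power n k s') x + ln 2) ->
  ln 2 <= e * N%:R ->
  code_rate L N s <= code_rate L n s' + e.
Proof.
move=> KL cs cs' n0 N0 k NE le small; have [sL _ _] := KL.
rewrite ler_pdivrMr ?ltr0n// mulrDl.
apply: (@le_trans _ _ (L (fun x =>
    code_length T kappa (k * n) (codebook_power n k s') x + ln 2))).
  apply: (le_state sL) => //; first exact: continuous_code.
  apply: continuous_addf; last exact: continuous_cstf.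
  by apply: continuous_code; exact: is_codebook_power.
rewrite (stateD sL); last 2 first.
- by apply: continuous_code; exact: is_codebook_power.
- exact: continuous_cstf.
rewrite (state_cst sL); apply: lerD => //.
rewrite (state_code_length_power kappa_ge kappa_le1)//.
by rewrite NE natrM mulrA [leRHS]mulrAC /code_rate divfK ?pnatr_eq0 -?lt0n// mulrC.
Qed.

(** The code is the even mixture of the repetitions of the two codes at a large
    common length: the mixture costs [ln 2] once, not per unit time. *)
Lemma code_rate_mix n1 s1 n2 s2 e : (0 < n1)%N -> (0 < n2)%N ->
  is_codebook s1 -> is_codebook s2 -> 0 < e ->
  exists N s, [/\ (0 < N)%N, is_codebook s & forall L, invariant_state T L ->
    code_rate L N s <= code_rate L n1 s1 + e /\
    code_rate L N s <= code_rate L n2 s2 + e].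
Proof.
move=> n10 n20 cs1 cs2 e0; pose k := (Num.bound (ln 2 / e : R)).+1.
pose N := (k * n2 * n1)%N.
have N0 : (0 < N)%N by rewrite !muln_gt0 n10 n20.
have small : ln 2 <= e * N%:R :> R.
  rewrite mulrC -ler_pdivrMr//; apply: (le_trans (ltW (archi_boundP _))).
    by apply: divr_ge0; [apply: ln_ge0; lra|exact: ltW].
  rewrite ler_nat (leq_trans (leqnSn _))// /N -/k -mulnA leq_pmulr//.
  by rewrite muln_gt0 n20.
have NE : (k * n2 * n1 = k * n1 * n2)%N by rewrite mulnAC.
pose s := codebook_mix (codebook_power n1 (k * n2) s1) (codebook_power n2 (k * n1) s2).
have cp1 : is_codebook (codebook_power n1 (k * n2) s1) by exact: is_codebook_power.
have cp2 : is_codebook (codebook_power n2 (k * n1) s2) by exact: is_codebook_power.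
have cs : is_codebook s by exact: is_codebook_mix.
exists N, s; split=> // L KL.
split; [apply: (rate_le_of_length KL cs cs1 n10 N0 (k := (k * n2)%N)) => // x
       |apply: (rate_le_of_length KL cs cs2 n20 N0 (k := (k * n1)%N)) => // x].
  by have [] := code_length_mix T kappa_ge kappa_le1 N x cp1 cp2.
by rewrite -NE; have [] := code_length_mix T kappa_ge kappa_le1 N x cp1 cp2.
Qed.

Let M (h : R) : set V := [set L | K L /\ forall N s, (0 < N)%N ->
  is_codebook s -> h <= code_rate L N s].

Let closed_M h : closed (M h).
Proof.
have -> : M h = K `&` \bigcap_(p in [set p : nat * codebook |
    (0 < p.1)%N /\ is_codebook p.2])
    [set L : V | h * p.1%:R <= L (code_length T kappa p.1 p.2)].
  apply/seteqP; split => L [KL hL]; split => //.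
    by move=> [N s] [/= N0 cs]; rewrite -ler_pdivlMr ?ltr0n//; exact: hL.
  by move=> N s N0 cs; rewrite ler_pdivlMr ?ltr0n//; exact: (hL (N, s)).
apply: closedI; first exact: closed_invariant_state.
by apply: closed_bigI => p _; exact: closed_eval_ge.
Qed.

(** By [code_rate_mix], the conditions imposed by the codes are directed, so that
    compactness applies. *)
Let M_nonempty h :
  (forall N s d, (0 < N)%N -> is_codebook s -> 0 < d ->
     exists2 L, K L & h - d <= code_rate L N s) -> M h !=set0.
Proof.
move=> hN; pose I := (nat * codebook (X := X) * R)%type.
pose D : set I := [set i | [/\ (0 < i.1.1)%N, is_codebook i.1.2 & 0 < i.2]].
pose C (i : I) : set V :=
  [set L | (h - i.2) * i.1.1%:R <= L (code_length T kappa i.1.1 i.1.2)].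
have CE i L : (0 < i.1.1)%N -> C i L = (h - i.2 <= code_rate L i.1.1 i.1.2).
  by move=> N0; rewrite /C/= ler_pdivlMr// ltr0n.
have [||i [N0 cs d0]|[[n1 s1] d1] [[n2 s2] d2]|L KL CL] :=
  @compact_directed_bigcap _ K I D C (@compact_invariant_state _ _ T compactX).
- by exists ((1%N, codebook_dirac (fun=> point)), 1); split=> //;
    exact: is_codebook_dirac.
- by move=> i _; exact: closed_eval_ge.
- have [L KL hL] := hN _ _ _ N0 cs d0; exists L; split=> //.
  by rewrite CE.
- move=> [/= n10 cs1 d10] [/= n20 cs2 d20].
  pose d := Num.min d1 d2 / 2.
  have d0 : 0 < d by rewrite divr_gt0// lt_min d10.
  have [N [s [N0 cs Ns]]] := code_rate_mix n10 n20 cs1 cs2 d0.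
  exists ((N, s), d) => // L [KL]; rewrite !CE//= => hL.
  have [l1 l2] := Ns L KL.
  have dd : d + d = Num.min d1 d2 by rewrite /d -splitr.
  have le1 : Num.min d1 d2 <= d1 by rewrite ge_min lexx.
  have le2 : Num.min d1 d2 <= d2 by rewrite ge_min lexx orbT.
  by split; rewrite CE//=; lra.
- exists L; split=> // N s N0 cs; apply/ler_addgt0Pl => d d0.
  rewrite addrC -lerBlDr.
  by have := CL ((N, s), d); rewrite CE//=; apply.
Qed.

(** The states all of whose codes have the largest possible rate form a face,
    because a mixture of two states is coded at about the mixture of their rates,
    and an extreme point of this face is ergodic. *)
Lemma ergodic_long_codes (h0 : R) :
  (forall N s, (0 < N)%N -> is_codebook s ->
     exists2 L, invariant_state T L & h0 <= code_rate L N s) ->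
  exists2 mu, ergodic_measures T mu & forall N s, (0 < N)%N -> is_codebook s ->
    h0 * N%:R <= expected_value mu (code_length T kappa N s).
Proof.
move=> h0P; pose H := [set h : R | forall N s, (0 < N)%N -> is_codebook s ->
  exists2 L, K L & h <= code_rate L N s].
have H0 : H h0 by move=> N s N0 cs; have [L KL hL] := h0P N s N0 cs; exists L.
have Hub : has_sup H.
  split; first by exists h0.
  exists lam => h Hh.
  have cd := is_codebook_dirac (fun=> point : X).
  have [L KL /le_trans] := Hh 1%N _ (ltn0Sn _) cd; apply.
  by have /andP[] := code_rate_bounds KL (ltn0Sn 0) cd.
pose h := sup H.
have h0h : h0 <= h by apply: sup_upper_bound.
have Mh : M h !=set0.
  apply: M_nonempty => N s d N0 cs d0.
  have [h' Hh' /ltW h'd] := sup_adherent d0 Hub.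
  by have [L KL hL] := Hh' N s N0 cs; exists L => //; exact: le_trans hL.
have maxh L e : K L -> 0 < e -> exists N s, [/\ (0 < N)%N, is_codebook s &
    code_rate L N s < h + e].
  move=> KL e0; apply: contrapT => no.
  suff : H (h + e).
    by move=> /(sup_upper_bound Hub); rewrite leNgt ltrDl e0.
  move=> N s N0 cs; exists L => //; rewrite leNgt; apply/negP => lt.
  by apply: no; exists N, s.
have mix1 t L1 L2 : 0 < t < 1 -> K L1 -> K L2 -> M h (mixture t L1 L2) -> M h L1.
  move=> /andP[t0 t1] K1 K2 [Kt ht]; split=> // n1 s1 n10 cs1.
  rewrite leNgt; apply/negP => lt1.
  pose g := h - code_rate L1 n1 s1.
  have g0 : 0 < g by rewrite subr_gt0.
  (* [e] is small enough for the gap [g] of [L1] to outweigh all errors *)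
  pose e := t * g / 4.
  have tg0 : 0 < t * g by rewrite mulr_gt0.
  have e0 : 0 < e by rewrite divr_gt0.
  have [n2 [s2 [n20 cs2 lt2]]] := maxh L2 e K2 e0.
  have [N [s [N0 cs Ns]]] := code_rate_mix n10 n20 cs1 cs2 e0.
  have [l1 _] := Ns L1 K1; have [_ l2] := Ns L2 K2.
  have := ht N s N0 cs.
  rewrite /code_rate /mixture mulrDl -!mulrA -/(code_rate _ _ _) -/(code_rate L2 _ _).
  have e4 : 4 * e = t * g by rewrite /e mulrC divfK.
  have {}l2 : code_rate L2 N s <= h + 2 * e by lra.
  have {}l1 : code_rate L1 N s <= h - g + e by rewrite /g; lra.
  have a1 : t * code_rate L1 N s <= t * (h - g + e) by rewrite ler_wpM2l// ltW.
  have a2 : (1 - t) * code_rate L2 N s <= (1 - t) * (h + 2 * e).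
    by rewrite ler_wpM2l// subr_ge0 ltW.
  have a3 : t * e <= e by rewrite ger_pMl// ltW.
  have a4 : 0 < t * e by rewrite mulr_gt0.
  by lra.
have [||L0 [K0 hL0] ext] := face_extreme_point (@compact_invariant_state _ _ T compactX)
    (closed_M (h := h)) _ _ Mh.
- by move=> L [].
- move=> t L1 L2 t01 K1 K2 Mt; split; first exact: mix1 Mt.
  apply: (mix1 (1 - t) L2 L1) => //; first by case/andP: t01 => ? ?; lra.
  suff -> : mixture (1 - t) L2 L1 = mixture t L1 L2 by [].
  by apply/funext => f; rewrite /mixture subKr addrC.
have [sL0 L0T L00] := K0.
have [mu muL0] := riesz_representation compactX sL0.
have muE : functional_of mu = L0.
  apply/funext => f; rewrite /functional_of; case: asboolP => cf; first exact: muL0.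
  by rewrite L00.
have inv : invariant_measures T mu.
  apply/(invariant_measureP compactX contT) => f cf; rewrite !muL0//; first exact: L0T.
  exact: (@continuous_comp_iter _ _ T contT f 1).
exists mu.
  by apply: (extreme_ergodic compactX contT inv) => t L1 L2; rewrite muE; exact: ext.
move=> N s N0 cs; rewrite muL0; last exact: continuous_code.
rewrite -ler_pdivlMr ?ltr0n//; apply: le_trans h0h _; exact: hL0.
Qed.

End LongCodes.

(** * Mutual information and finite colorings *)

Section FiniteInformation.
Context {R : realType}.

Lemma ln_ge1BV (x : R) : 0 < x -> 1 - x^-1 <= ln x.
Proof.
move=> x0; rewrite -[x in ln x]invrK lnV ?posrE ?invr_gt0// lerBlDr -lerBlDl.
rewrite opprK addrC; apply: (@le_trans _ _ (expR (ln x^-1))).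
  by rewrite addrC expR_ge1Dx.
by rewrite lnK// posrE invr_gt0.
Qed.

Context {I J : finType} (p : I -> J -> R) (v : I -> J -> R).
Hypothesis p_ge0 : forall i j, 0 <= p i j.
Let p1 i := \sum_j p i j.
Let p2 j := \sum_i p i j.
Hypothesis p_sum1 : \sum_i p1 i = 1.

(** Gibbs' inequality: for each value of the first variable, the relative entropy
    of the conditional law with respect to [p2] is the supremum over [v] of such
    expressions. *)
Lemma gibbs_inequality :
  \sum_i \sum_j p i j * v i j - \sum_i p1 i * ln (\sum_j p2 j * expR (v i j))
  <= \sum_i \sum_j p i j * ln (p i j / (p1 i * p2 j)).
Proof.
pose Z i := \sum_j p2 j * expR (v i j).
have p1_ge0 i : 0 <= p1 i by exact: sumr_ge0.
have p2_ge0 j : 0 <= p2 j by exact: sumr_ge0.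
have Z_ge0 i : 0 <= Z i by apply: sumr_ge0 => j _; rewrite mulr_ge0// expR_ge0.
have term i j : p i j * (v i j - ln (Z i)) <=
    p i j * ln (p i j / (p1 i * p2 j)) + (p1 i * (p2 j * expR (v i j) / Z i) - p i j).
  have [->|pij0] := eqVneq (p i j) 0.
    rewrite !mul0r add0r subr0 mulr_ge0// divr_ge0// mulr_ge0//; exact: expR_ge0.
  have pij : 0 < p i j by rewrite lt_neqAle eq_sym pij0 p_ge0.
  have p1i : 0 < p1 i.
    by rewrite /p1 (bigD1 j)//= ltr_pwDl// sumr_ge0.
  have p2j : 0 < p2 j.
    by rewrite /p2 (bigD1 i)//= ltr_pwDl// sumr_ge0.
  have Zi : 0 < Z i.
    rewrite /Z (bigD1 j)//= ltr_pwDl// ?mulr_gt0 ?expR_gt0// sumr_ge0// => k _.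
    by rewrite mulr_ge0// expR_ge0.
  have := @ln_ge1BV (p i j / (p1 i * p2 j) / (expR (v i j) / Z i)).
  rewrite !divr_gt0 ?mulr_gt0 ?expR_gt0// => /(_ isT).
  rewrite ln_div ?posrE ?divr_gt0 ?mulr_gt0 ?expR_gt0//.
  rewrite [ln (expR _ / _)]ln_div ?posrE ?expR_gt0// expRK.
  move=> /(ler_wpM2l (ltW pij)); rewrite mulrBr mulr1.
  have -> : p i j * (p i j / (p1 i * p2 j) / (expR (v i j) / Z i))^-1 =
      p1 i * (p2 j * expR (v i j) / Z i).
    by field; rewrite !gt_eqF ?expR_gt0.
  rewrite [p i j * (_ - (_ - _))]mulrBr; lra.
have : \sum_i \sum_j p i j * (v i j - ln (Z i)) <=
    \sum_i \sum_j (p i j * ln (p i j / (p1 i * p2 j))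
      + (p1 i * (p2 j * expR (v i j) / Z i) - p i j)).
  by apply: ler_sum => i _; apply: ler_sum => j _; exact: term.
under [X in _ <= X -> _]eq_bigr do rewrite big_split/= big_split/= sumrN -mulr_sumr
  -mulr_suml.
rewrite !big_split/= sumrN p_sum1.
under [X in X <= _ -> _]eq_bigr do
  (under eq_bigr do rewrite mulrBr; rewrite big_split/= sumrN -mulr_suml).
rewrite big_split/= sumrN => h; apply: le_trans h _.
rewrite gerDl subr_le0 -p_sum1; apply: ler_sum => i _.
have [->|Z0] := eqVneq (Z i) 0; first by rewrite invr0 !mulr0.
by rewrite -/(Z i) divff// mulr1.
Qed.

End FiniteInformation.

Section Colorings.
Context {R : realType} {d dA dY : measure_display} {Omega : measurableType d}
  {A : measurableType dA} {Y : measurableType dY}.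
Variables (P : probability Omega R) (xi : {RV P >-> A}) (eta : {RV P >-> Y}).

Lemma fine_probability_partition {J : finType} (D : J -> set Omega) (E : set Omega) :
  (forall j, measurable (D j)) -> trivIset setT D -> (forall w, exists j, D j w) ->
  measurable E -> fine (P E) = \sum_j fine (P (E `&` D j)).
Proof.
move=> mD tD cD mE; have mED j : measurable (E `&` D j) by exact: measurableI.
apply: EFin_inj; rewrite fineK ?fin_num_measure// -sumEFin.
under eq_bigr do rewrite fineK ?fin_num_measure//.
have {1}-> : E = \bigcup_(j in [set: J]) (E `&` D j).
  by apply/seteqP; split => [w Ew|w [j _ []]//]; have [j Dj] := cD w; exists j.
rewrite measure_fin_bigcup//; last first.
- by move=> i j _ _ [w [[_ Di] [_ Dj]]]; apply: tD => //; exists w.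
- exact: finite_finset.
rewrite (@fsbigTE _ _ _ _ [fset j in J]%fset) => [|j]; last by rewrite !inE.
by rewrite big_uniq ?fset_uniq//=; apply: eq_bigl => j; rewrite !inE.
Qed.

Lemma fine_probability_fibers {J : finType} (c : Omega -> J) (E : set Omega) :
  (forall j, measurable (c @^-1` [set j])) -> measurable E ->
  fine (P E) = \sum_j fine (P (E `&` c @^-1` [set j])).
Proof.
move=> mc; apply: fine_probability_partition => // [i j _ _ [w [<- <-]]//|w].
by exists (c w).
Qed.

Implicit Types (I J : finType).

Definition coloring {d'} {B : measurableType d'} {I} (c : B -> I) :=
  forall i, measurable (c @^-1` [set i]).

Definition joint_law {I J} (a : A -> I) (b : Y -> J) (i : I) (j : J) : R :=
  fine (P (xi @^-1` (a @^-1` [set i]) `&` eta @^-1` (b @^-1` [set j]))).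

Section TwoColorings.
Context {I J} (a : A -> I) (b : Y -> J).
Hypothesis ma : coloring a.
Hypothesis mb : coloring b.

Let mxi i : measurable (xi @^-1` (a @^-1` [set i])).
Proof. by rewrite -[X in measurable X]setTI; exact: measurable_funPT. Qed.

Let meta j : measurable (eta @^-1` (b @^-1` [set j])).
Proof. by rewrite -[X in measurable X]setTI; exact: measurable_funPT. Qed.

Lemma joint_law_ge0 i j : 0 <= joint_law a b i j.
Proof. exact: fine_ge0. Qed.

Lemma sum_joint_law i :
  \sum_j joint_law a b i j = fine (P (xi @^-1` (a @^-1` [set i]))).
Proof. by rewrite (@fine_probability_fibers _ (b \o eta)). Qed.

Lemma sum_joint_lawr j :
  \sum_i joint_law a b i j = fine (P (eta @^-1` (b @^-1` [set j]))).
Proof.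
rewrite (@fine_probability_fibers _ (a \o xi))//.
by apply: eq_bigr => i _; rewrite setIC.
Qed.

Lemma sum_sum_joint_law : \sum_i \sum_j joint_law a b i j = 1.
Proof.
under eq_bigr do rewrite sum_joint_law.
have := @fine_probability_fibers _ (a \o xi) setT mxi measurableT.
rewrite probability_setT/= => ->.
by apply: eq_bigr => i _; rewrite setTI.
Qed.

(** The nonempty fibers of two colorings are partitions, and the empty ones do
    not contribute. *)
Lemma coloring_information_le :
  ((\sum_i \sum_j joint_law a b i j * ln (joint_law a b i j /
      ((\sum_j' joint_law a b i j') * (\sum_i' joint_law a b i' j))))%:E
   <= mutual_information xi eta)%E.
Proof.
have part d' (B : measurableType d') (I' : finType) (c : B -> I') : coloring c ->
    measurable_partition (fun k : 'I_#|[pred i | `[< c @^-1` [set i] !=set0 >]]| =>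
      c @^-1` [set enum_val k]).
  move=> mc; split => [k|]; first exact: mc.
  split.
  - apply/seteqP; split => // x _.
    have cx : c x \in [pred i | `[< c @^-1` [set i] !=set0 >]].
      by rewrite inE; exists x.
    by exists (enum_rank_in cx (c x)) => //=; rewrite enum_rankK_in.
  - by move=> k l _ _ [x [/= -> /enum_val_inj]].
  - by move=> k _; have := enum_valP k; rewrite inE.
apply: ereal_sup_ubound.
exists #|[pred i | `[< a @^-1` [set i] !=set0 >]]|,
  #|[pred j | `[< b @^-1` [set j] !=set0 >]]|,
  (fun k => a @^-1` [set enum_val k]), (fun k => b @^-1` [set enum_val k]).
split; [exact: part|exact: part|congr EFin].
have joint0l i j : ~ (a @^-1` [set i] !=set0) -> joint_law a b i j = 0.
  move=> /set0P/negP/negPn/eqP a0.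
  by rewrite /joint_law a0 preimage_set0 set0I measure0.
have joint0r i j : ~ (b @^-1` [set j] !=set0) -> joint_law a b i j = 0.
  move=> /set0P/negP/negPn/eqP b0.
  by rewrite /joint_law b0 preimage_set0 setI0 measure0.
rewrite /partition_information.
pose G i j := joint_law a b i j * ln (joint_law a b i j /
  (fine (P (xi @^-1` (a @^-1` [set i]))) * fine (P (eta @^-1` (b @^-1` [set j]))))).
transitivity (\sum_i \sum_j G i j).
  apply: eq_bigr => i _; apply: eq_bigr => j _.
  by rewrite sum_joint_law sum_joint_lawr.
rewrite -(big_enum_val (fun i => \sum_(l < _)
  G i (enum_val (A := [pred j | `[< b @^-1` [set j] !=set0 >]]) l))) /=.
rewrite [LHS](bigID (mem [pred i | `[< a @^-1` [set i] !=set0 >]]))/=.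
rewrite [X in _ + X]big1 ?addr0 => [|i]; last first.
  rewrite inE => /asboolPn ai; apply: big1 => j _.
  by rewrite /G joint0l// mul0r.
apply: eq_bigr => i _; rewrite -(big_enum_val (G i)) /=.
rewrite [LHS](bigID (mem [pred j | `[< b @^-1` [set j] !=set0 >]]))/=.
rewrite [X in _ + X]big1 ?addr0// => j.
by rewrite inE => /asboolPn bj; rewrite /G joint0r// mul0r.
Qed.

Lemma gibbs_mutual_information (v : I -> J -> R) :
  ((\sum_i \sum_j joint_law a b i j * v i j
    - \sum_i (\sum_j joint_law a b i j) *
        ln (\sum_j (\sum_i' joint_law a b i' j) * expR (v i j)))%:E
   <= mutual_information xi eta)%E.
Proof.
apply: le_trans coloring_information_le; rewrite lee_fin.
by apply: gibbs_inequality; [exact: joint_law_ge0|exact: sum_sum_joint_law].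
Qed.

End TwoColorings.

(** Each term is at most the corresponding term of the entropy of the second
    partition, of which at most [k] cells have positive probability. *)
Lemma mutual_information_le_ln (k : nat) (s : seq Y) :
  (size s <= k)%N -> (forall w, eta w \in s) ->
  (mutual_information xi eta <= (ln k%:R)%:E)%E.
Proof.
move=> sk etas; apply: ge_ereal_sup => _ [m [n [F [G [[mF [cF tF _]]
  [mG [cG tG _]] ->]]]]]; rewrite lee_fin.
have mxi i : measurable (xi @^-1` F i).
  by rewrite -[X in measurable X]setTI; exact: measurable_funPT.
have meta j : measurable (eta @^-1` G j).
  by rewrite -[X in measurable X]setTI; exact: measurable_funPT.
pose p i j := fine (P (xi @^-1` F i `&` eta @^-1` G j)).
pose q j := fine (P (eta @^-1` G j)).
have q_ge0 j : 0 <= q j by exact: fine_ge0.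
have p_ge0 i j : 0 <= p i j by exact: fine_ge0.
have sump j : \sum_i p i j = q j.
  rewrite /q (@fine_probability_partition _ (fun i => xi @^-1` F i))//.
  - by apply: eq_bigr => i _; rewrite /p setIC.
  - by move=> i i' _ _ [w [Fi Fi']]; apply: tF => //; exists (xi w).
  - by move=> w; have : setT (xi w) by []; rewrite -cF => -[i _ Fi]; exists i.
have sumq : \sum_j q j = 1.
  have := @fine_probability_partition _ (fun j => eta @^-1` G j) setT meta.
  rewrite probability_setT/= => -> //.
  - by apply: eq_bigr => j _; rewrite setTI.
  - by move=> j j' _ _ [w [Gj Gj']]; apply: tG => //; exists (eta w).
  - by move=> w; have : setT (eta w) by []; rewrite -cG => -[j _ Gj]; exists j.
have k0 : 0 < k%:R :> R.
  by rewrite ltr0n; apply: leq_trans sk; have := etas point; case: (s).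
have cell_le i j : p i j * ln (p i j / (fine (P (xi @^-1` F i)) * q j)) <=
    - (p i j * ln (q j)).
  have [->|pij0] := eqVneq (p i j) 0; first by rewrite !mul0r oppr0.
  have pij : 0 < p i j by rewrite lt_neqAle eq_sym pij0 p_ge0.
  have ple : p i j <= fine (P (xi @^-1` F i)).
    apply: fine_le; [by rewrite fin_num_measure//; exact: measurableI
      |by rewrite fin_num_measure|].
    by apply: le_measure; rewrite ?inE//; exact: measurableI.
  have pF := lt_le_trans pij ple.
  have qj : 0 < q j.
    by rewrite -sump (bigD1 i)//= ltr_pwDl// sumr_ge0.
  rewrite -mulrN ler_wpM2l// -lnV ?posrE// ler_ln ?posrE ?invr_gt0 ?divr_gt0
    ?mulr_gt0//.
  by rewrite invfM mulrA ler_piMl ?invr_ge0// ler_pdivrMr// mul1r.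
have entropy_le j : - (q j * ln (q j)) <=
    (if q j == 0 then 0 else k%:R^-1) - q j + q j * ln k%:R.
  have [->|qj0] := eqVneq (q j) 0; first by rewrite !mul0r subrr add0r oppr0.
  have qj : 0 < q j by rewrite lt_neqAle eq_sym qj0 q_ge0.
  have := ln_ge1BV (mulr_gt0 qj k0); rewrite lnM ?posrE//.
  move=> /(ler_wpM2l (ltW qj)); rewrite mulrBr mulr1 invfM mulrA divff ?gt_eqF//.
  by rewrite mul1r mulrDr; lra.
have card_le : #|[pred j | q j != 0]|%:R <= k%:R :> R.
  have /choice[g gP] j : exists y, q j != 0 -> y \in s /\ G j y.
    have [qj|qj] := eqVneq (q j) 0; first by exists point.
    suff [w Gw] : eta @^-1` G j !=set0 by exists (eta w).
    by apply/set0P; apply: contra_neq qj => G0; rewrite /q G0 measure0.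
  rewrite ler_nat; apply: leq_trans sk.
  rewrite cardE -(size_map g); apply: uniq_leq_size.
    rewrite map_inj_in_uniq ?enum_uniq// => j j'.
    rewrite !mem_enum !inE => /gP[_ gj] /gP[_ gj'] gE.
    by apply: tG => //; exists (g j); split => //; rewrite gE.
  by move=> _ /mapP[j + ->]; rewrite mem_enum inE => /gP[].
apply: (@le_trans _ _ (\sum_j - (q j * ln (q j)))).
  rewrite /partition_information exchange_big/=; apply: ler_sum => j _.
  apply: (@le_trans _ _ (\sum_i - (p i j * ln (q j)))).
    by apply: ler_sum => i _; exact: cell_le.
  by rewrite sumrN -mulr_suml sump.
apply: (@le_trans _ _ (\sum_j ((if q j == 0 then 0 else k%:R^-1) - q j
    + q j * ln k%:R))).
  by apply: ler_sum => j _; exact: entropy_le.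
rewrite big_split/= sumrB sumq -mulr_suml sumq mul1r gerDr subr_le0.
rewrite (eq_bigr (fun j => if q j != 0 then k%:R^-1 else 0)) => [|j _]; last by case: eqP.
rewrite -big_mkcond/= sumr_const -[leLHS]mulr_natl ler_pdivrMr// mul1r.
exact: card_le.
Qed.

End Colorings.

(** * Bounds on the rate distortion function *)

Section MeasurableColorings.
Context {R : realType}.

Lemma measurable_comp_coloring d d' (B : measurableType d) (C : measurableType d')
    (I : finType) (c : B -> I) (g : I -> C) :
  coloring c -> measurable_fun setT (g \o c).
Proof.
move=> mc _ D mD; rewrite setTI.
have -> : (g \o c) @^-1` D = \bigcup_(i in [set i | D (g i)]) c @^-1` [set i].
  apply/seteqP; split => [x Dx|x [i Dgi cxi]]; first by exists (c x).
  by move: Dgi; rewrite /= -[i]cxi.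
by apply: fin_bigcup_measurable => [|i _]; [exact: finite_finset|exact: mc].
Qed.

Lemma integral_comp_coloring d (Omega : measurableType d) (P : probability Omega R)
    (I : finType) (c : Omega -> I) (g : I -> R) :
  coloring c -> (forall i, 0 <= g i) ->
  (\int[P]_w (g (c w))%:E = (\sum_i g i * fine (P (c @^-1` [set i])))%:E)%E.
Proof.
move=> mc g0.
have -> : (fun w => (g (c w))%:E : \bar R) =
    (fun w => \sum_i (g i * \1_(c @^-1` [set i]) w)%:E)%E.
  apply/funext => w; rewrite (bigD1 (c w))//= indicE mem_set// mulr1.
  rewrite big1 ?adde0// => i ic; rewrite indicE memNset ?mulr0// => /= cw.
  by rewrite cw eqxx in ic.
rewrite ge0_integral_sum//; last 2 first.
- by move=> i; apply/measurable_EFinP; apply: measurable_funM.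
- by move=> i w _; rewrite lee_fin mulr_ge0.
rewrite -sumEFin; apply: eq_bigr => i _.
under eq_integral do rewrite EFinM.
rewrite ge0_integralZl//; last 2 first.
- by apply/measurable_EFinP; exact: (measurable_indic (mc i)).
- by rewrite lee_fin.
by rewrite integral_indic// setIT EFinM fineK// fin_num_measure.
Qed.

(** Immediate from the definition of the integral of a nonnegative function as a
    supremum over the simple functions below it.  This is applied to the distortion
    count, a function of two points. *)
Lemma ge0_le_integral_nonmeasurable d (Omega : measurableType d)
    (P : {measure set Omega -> \bar R}) (f g : Omega -> \bar R) :
  (forall w, 0 <= f w)%E -> (forall w, f w <= g w)%E ->
  (\int[P]_w f w <= \int[P]_w g w)%E.
Proof.
move=> f0 fg; rewrite !ge0_integralTE// => [|w]; last exact: le_trans (fg w).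
apply: ge_ereal_sup => _ [h /= hf <-]; apply: ereal_sup_ubound.
by exists h => //= w; exact: le_trans (fg w).
Qed.

End MeasurableColorings.

Section OpenColorings.
Context {R : realType} {X : pmetricType R}.

Lemma open_forall (I : finType) (F : I -> set X) :
  (forall i, open (F i)) -> open [set x | forall i, F i x].
Proof.
move=> oF; rewrite openE => x Fx; apply: filter_forall => i.
exact: (open_nbhs_nbhs (conj (oF i) (Fx i))).
Qed.

Lemma open_orbit_ball (T : X -> X) (n : nat) (y : X) (e : R) : continuous T ->
  open [set x | forall k : 'I_n, mdist (iter k T x) (iter k T y) < e].
Proof.
move=> contT; apply: (@open_forall 'I_n
  (fun k => [set x | mdist (iter k T x) (iter k T y) < e])) => k.
apply: (@open_comp _ _ (fun x => mdist (iter k T x) (iter k T y))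
  [set r | r < e]) => [x _|]; last exact: open_lt.
exact: (@continuous_comp_iter _ _ T contT
  (fun z => mdist z (iter k T y)) k (@continuous_mdistl _ _ _)).
Qed.

(** Points are coloured by the first member of a finite open cover that contains
    them. *)
Lemma seq_open_coloring (s : seq X) (U : X -> set X) :
  (forall z, open (U z)) -> (forall x, exists2 z, z \in s & U z x) ->
  exists c : borel X -> 'I_(size s), coloring c /\
    forall x, U (nth point s (c x)) x.
Proof.
move=> oU cov; pose u x := [pred z | `[< U z x >]].
have has_u x : (find (u x) s < size s)%N.
  rewrite -has_find; apply/hasP; have [z zs Uz] := cov x.
  by exists z => //; apply/asboolP.
exists (fun x => Ordinal (has_u x)); split => [i|x] /=; last first.
  by have := has_u x; rewrite -has_find => /(nth_find point) /asboolP.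
have mU z : measurable (U z : set (borel X)) by exact: sub_sigma_algebra.
have -> : (fun x => Ordinal (has_u x)) @^-1` [set i] = U (nth point s i) `&`
    \bigcap_(j in [set j : 'I_(size s) | (j < i)%N]) ~` U (nth point s j).
  apply/seteqP; split => x /=.
  - move=> <- /=; split.
      by have := has_u x; rewrite -has_find => /(nth_find point) /asboolP.
    move=> j /= /(before_find point) ; rewrite /u/=.
    by case: asboolP.
  - move=> [Ui Uj]; apply/val_inj => /=.
    apply/eqP; rewrite eqn_leq; apply/andP; split; rewrite leqNgt; apply/negP => lt.
      by have := before_find point lt; rewrite /u/= ; case: asboolP.
    apply: (Uj (Ordinal (has_u x)) lt) => /=.
    by have := has_u x; rewrite -has_find => /(nth_find point) /asboolP.
apply: measurableI => //; apply: fin_bigcap_measurable => [|j _].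
  exact: finite_finset.
exact: measurableC.
Qed.

Lemma compact_open_coloring (U : X -> set X) : compact [set: X] ->
  (forall z, open (U z)) -> (forall x, U x x) ->
  exists m (z : 'I_m -> X) (c : borel X -> 'I_m), coloring c /\
    forall x, U (z (c x)) x.
Proof.
rewrite compact_cover => cX oU Uxx.
have [x _|D _ cov] := cX X setT U (fun i _ => oU i); first by exists x.
have [|c [mc Uc]] := @seq_open_coloring D U oU.
  by move=> x; have [z zD Uz] := cov x I; exists z.
by exists (size D), (fun i => nth point D i), c.
Qed.

End OpenColorings.

Section RateUpperBound.
Context {R : realType} {X : pmetricType R}.
Variable T : X -> X.
Hypothesis compactX : compact [set: X].
Hypothesis contT : continuous T.
Implicit Types (mu : probability (borel X) R).

Lemma rate_distortion_at_nonincreasing mu eps s s' : s <= s' ->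
  (rate_distortion_at T mu eps s' <= rate_distortion_at T mu eps s)%E.
Proof.
move=> ss'; apply: le_ereal_inf => _ [n [d [Om [P [xi [eta [n0 [law E] ->]]]]]]].
exists n, d, Om, P, xi, eta; split=> //; split=> //.
by apply: lt_le_trans E _; rewrite lee_fin ler_wpM2r.
Qed.

Lemma rate_distortion_sup mu eps : rate_distortion T mu eps =
  ereal_sup [set rate_distortion_at T mu eps s | s in [set s | 0 < s]].
Proof.
have -> : [set s : R | 0 < s] = [set` `]0, +oo[] by apply/seteqP; split => x /=;
  rewrite in_itv/= andbT.
apply: cvg_lim => //.
apply: (@nonincreasing_at_right_cvge R (rate_distortion_at T mu eps) 0 +oo%O) => //.
by move=> s s' _ _; exact: rate_distortion_at_nonincreasing.
Qed.

(** Quantizing a point to an orbit segment that follows it is a code without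
    distortion. *)
Lemma rate_distortion_at_le_spanning mu eps s n (E : {fset X}) :
  0 < eps -> 0 < s -> (0 < n)%N -> spanning T n eps E ->
  (rate_distortion_at T mu eps s <= (ln #|` E|%:R / n%:R)%:E)%E.
Proof.
move=> eps0 s0 n0 spanE.
pose U y := [set x | bowen_dist T n x y < eps].
have oU y : open (U y).
  have -> : U y = [set x | forall k : 'I_n, mdist (iter k T x) (iter k T y) < eps].
    apply/seteqP; split => x /=.
      by move=> /(bowen_distP _ _ _ _ eps0) xy k; exact: xy.
    by move=> xy; apply/bowen_distP => // k kn; exact: (xy (Ordinal kn)).
  exact: open_orbit_ball.
have [c [mc Uc]] := seq_open_coloring oU spanE.
pose word (i : 'I_(size E)) : n.-tuple (borel X) :=
  [tuple iter k T (nth point E i) | k < n].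
have mword : measurable_fun setT (word \o c) by exact: measurable_comp_coloring.
pose eta : {RV mu >-> n.-tuple (borel X)} :=
  HB.pack (word \o c) (isMeasurableFun.Build _ _ _ _ _ mword).
have mid : measurable_fun setT (id : borel X -> borel X) by exact: measurable_id.
pose xi : {RV mu >-> borel X} :=
  HB.pack (id : borel X -> borel X) (isMeasurableFun.Build _ _ _ _ _ mid).
apply: (@le_trans _ _ (mutual_information xi eta / n%:R%:E)%E).
  apply: ereal_inf_lbound; exists n, _, _, mu, xi, eta; split=> //; split=> //.
  rewrite unlock.
  under eq_integral => x _.
    have -> : (distortion_count T eps (xi x) (eta x)) = 0%N.
      apply: eq_card0 => k; rewrite !inE/= tnth_mktuple; apply/negbTE.
      by rewrite -ltNge; have /(bowen_distP _ _ _ _ eps0) := Uc x; apply.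
    over.
  by rewrite integral0 lte_fin mulr_gt0// ltr0n.
rewrite lee_div_fin ?ltr0n// divfK ?pnatr_eq0 -?lt0n//.
apply: (@mutual_information_le_ln _ _ _ _ _ _ _ _ xi eta _
  [seq word i | i <- enum 'I_(size E)]).
  by rewrite size_map size_enum_ord.
by move=> x; apply/mapP; exists (c x) => //; rewrite mem_enum.
Qed.

Lemma spanning_number_attained n eps : (exists E, spanning T n eps E) ->
  exists2 E, spanning T n eps E & spanning_number T n eps = (#|` E|%:R)%:E.
Proof.
move=> [E0 spanE0].
pose Q k := `[< exists2 E, spanning T n eps E & #|` E| = k >].
have Q0 : exists k, Q k by exists #|` E0|; apply/asboolP; exists E0.
case: (ex_minnP Q0) => k /asboolP[E spanE <-] minE; exists E => //.
apply/eqP; rewrite eq_le; apply/andP; split.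
  by apply: ereal_inf_lbound; exists E.
apply: le_ereal_inf_tmp => _ [E' /= spanE' <-]; rewrite lee_fin ler_nat.
by apply: minE; apply/asboolP; exists E'.
Qed.

Lemma rate_distortion_le_spanning_rate mu eps : 0 < eps ->
  (rate_distortion T mu eps <= spanning_rate T eps)%E.
Proof.
move=> eps0; rewrite rate_distortion_sup; apply: ge_ereal_sup => _ [s /= s0 <-].
rewrite /spanning_rate /limn_esup limf_esupE; apply: le_ereal_inf_tmp => _ [V [N _ NV] <-].
pose n := maxn N 1; have n0 : (0 < n)%N by rewrite leq_max orbT.
have Vn : V n by apply: NV; rewrite /= leq_maxl.
apply: (@le_trans _ _ (lne (spanning_number T n eps) / n%:R%:E)%E); last first.
  by apply: ereal_sup_ubound; exists n.
have [spanE|none] := pselect (exists E, spanning T n eps E).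
  have [E spE ->] := spanning_number_attained spanE.
  have E0 : (0 < #|` E|)%N.
    have [y yE _] := spE point; rewrite lt0n cardfs_eq0; apply/eqP => E0.
    by rewrite E0 in_fset0 in yE.
  rewrite lne_EFin ?ltr0n// inver pnatr_eq0 gt_eqF//= -EFinM.
  exact: rate_distortion_at_le_spanning.
have -> : spanning_number T n eps = +oo%E.
  apply/eqP; rewrite -leye_eq; apply: le_ereal_inf_tmp => v [E spE _].
  by exfalso; apply: none; exists E.
by rewrite /= inver pnatr_eq0 gt_eqF// gt0_mulye ?leey// lte_fin invr_gt0 ltr0n.
Qed.

End RateUpperBound.

Section RateLowerBound.
Context {R : realType} {X : pmetricType R}.
Variables (T : X -> X) (kappa : X -> X -> R) (lam eps : R).
Hypothesis compactX : compact [set: X].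
Hypothesis contT : continuous T.
Hypothesis eps_gt0 : 0 < eps.
Hypothesis lam_ge0 : 0 <= lam.
Hypothesis kappa_continuous : forall x', continuous (fun x => kappa x x').
Hypothesis kappa_ge : forall x x', expR (- lam) <= kappa x x'.
Hypothesis kappa_le1 : forall x x', kappa x x' <= 1.
Hypothesis kappa_near : forall x x', mdist x x' < 2 * eps -> kappa x x' = 1.

Let mistakes n (x : X) (y : nat -> X) : nat :=
  #|[pred k : 'I_n | 2 * eps <= mdist (iter k T x) (y k)]|.

Let ln_word_likelihood n x y :
  - (lam * (mistakes n x y)%:R) <= ln (word_likelihood T kappa n y x).
Proof.
rewrite -[leLHS]expRK ler_ln ?posrE ?expR_gt0//; last first.
  have /andP[+ _] := word_likelihood_bounds T kappa_ge kappa_le1 n y x.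
  by apply: lt_le_trans; exact: expR_gt0.
rewrite -mulNr expRM_natr /word_likelihood (bigID (fun k : 'I_n =>
  2 * eps <= mdist (iter k T x) (y k)))/= [X in _ * X]big1 ?mulr1 => [|k]; last first.
  by rewrite -ltNge => /kappa_near.
rewrite /mistakes -prodr_const; apply: ler_prod => k _.
by rewrite expR_ge0 kappa_ge.
Qed.

(** The law of the finely quantized second variable is a codebook, and Gibbs'
    inequality applies with the logarithm of the likelihood of the codewords as the
    test function. *)
Lemma mutual_information_ge (mu : probability (borel X) R) (h s : R) n :
  (0 < n)%N ->
  (forall cb, is_codebook cb -> h * n%:R <= expected_value mu (code_length T kappa n cb)) ->
  forall d (Om : measurableType d) (P : probability Om R)
    (xi : {RV P >-> borel X}) (eta : {RV P >-> n.-tuple (borel X)}),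
  distortion_admissible T mu eps s xi eta ->
  (((h - lam * s) * n%:R)%:E <= mutual_information xi eta)%E.
Proof.
move=> n0 hcode d Om P xi eta [law distE].
rewrite unlock in distE.
have e2 : 0 < eps / 2 by rewrite divr_gt0.
have [||M [zc [cc [mcc near_cc]]]] := @compact_open_coloring _ X
  (fun z => [set x | forall k : 'I_1, mdist (iter k T x) (iter k T z) < eps / 2])
  compactX.
- by move=> z; exact: (@open_orbit_ball R X T 1 z (eps / 2) contT).
- by move=> x k; rewrite mdistxx.
have {}near_cc x : mdist x (zc (cc x)) < eps / 2 by exact: (near_cc x ord0).
pose J : finType := {ffun 'I_n -> 'I_M}.
pose b (y : n.-tuple (borel X)) : J := [ffun k => cc (tnth y k)].
have mb : coloring b.
  move=> j; have -> : b @^-1` [set j] = \bigcap_(k in [set: 'I_n])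
      ((fun y => tnth y k) @^-1` (cc @^-1` [set j k])).
    apply/seteqP; split => y /=.
      by move=> /ffunP bj k _; rewrite -bj ffunE.
    by move=> bj; apply/ffunP => k; rewrite ffunE; exact: bj.
  apply: fin_bigcap_measurable => [|k _]; first exact: finite_finset.
  rewrite -[X in measurable X]setTI; exact: (measurable_tnth k measurableT (mcc (j k))).
pose y_ (j : J) : nat -> X := fun k =>
  if insub k is Some k' then zc (j k') else point.
have y_E (j : J) (k : 'I_n) : y_ j k = zc (j k) by rewrite /y_ valK.
pose q j := fine (P (eta @^-1` (b @^-1` [set j]))).
pose cb : codebook (X := X) := [seq (q j, y_ j) | j <- enum J].
have meta j : measurable (eta @^-1` (b @^-1` [set j])).
  by rewrite -[X in measurable X]setTI; exact: measurable_funPT.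
have ccb : is_codebook cb.
  split; first by rewrite all_map; apply/allP => j _ /=; exact: fine_ge0.
  rewrite big_map big_enum/=.
  have := @fine_probability_fibers _ _ _ P _ (b \o eta) setT meta measurableT.
  rewrite probability_setT/= => ->; apply: eq_bigr => j _.
  by rewrite setTI.
pose f := code_length T kappa n cb.
have cf : continuous f by apply: (@continuous_code_length _ _ _ _ lam).
have f_ge0 x : 0 <= f x.
  by have /andP[] := code_length_bounds T kappa_ge kappa_le1 n x ccb.
have likE x : likelihood T kappa n cb x =
    \sum_j q j * word_likelihood T kappa n (y_ j) x.
  by rewrite /likelihood big_map big_enum.
apply/lee_addgt0Pr => e e0.
have [||m [za [a [ma near_a]]]] := @compact_open_coloring _ X
  (fun z => [set x | forall k : 'I_n, mdist (iter k T x) (iter k T z) < eps / 2]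
     `&` [set x | f x < f z + e / 2]) compactX.
- move=> z; apply: openI; first exact: (@open_orbit_ball R X T n z (eps / 2) contT).
  apply: (@open_comp _ _ f [set t | t < f z + e / 2]) => [x _|]; [exact: cf|exact: open_lt].
- by move=> x; split => /= [k|]; rewrite ?mdistxx// ltrDl divr_gt0.
have mxi i : measurable (xi @^-1` (a @^-1` [set i])).
  by rewrite -[X in measurable X]setTI; exact: measurable_funPT.
pose v (i : 'I_m) (j : J) := ln (word_likelihood T kappa n (y_ j) (za i)).
have qE j : \sum_i joint_law xi eta a b i j = q j by exact: sum_joint_lawr.
have pE i : \sum_j joint_law xi eta a b i j = fine (mu (a @^-1` [set i])).
  by rewrite sum_joint_law//; congr fine; exact: law.
have mu_sum1 : \sum_i fine (mu (a @^-1` [set i])) = 1.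
  have := @fine_probability_fibers _ _ _ mu _ a setT ma measurableT.
  by rewrite probability_setT/= => ->; apply: eq_bigr => i _; rewrite setTI.
(* the second sum in Gibbs' inequality is the mean length of the code [cb] *)
have length_ge : h * n%:R - e / 2 <= \sum_i fine (mu (a @^-1` [set i])) * f (za i).
  rewrite lerBlDr; apply: le_trans (hcode cb ccb) _.
  have : (\int[mu]_x (f x)%:E <= \int[mu]_x (f (za (a x)) + e / 2)%:E)%E.
    apply: ge0_le_integral_nonmeasurable => x; rewrite lee_fin//.
    by have [_ /ltW] := near_a x.
  rewrite (@integral_comp_coloring _ _ _ mu _ a (fun i => f (za i) + e / 2))//;
    last by move=> i; rewrite addr_ge0// divr_ge0// ltW.
  move=> le; rewrite /expected_value /Rintegral -lee_fin fineK; last first.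
    by apply: integrable_fin_num => //; exact: continuous_integrable.
  apply: le_trans le _; rewrite lee_fin.
  under eq_bigr do rewrite mulrDl; rewrite big_split/= -mulr_sumr mu_sum1 mulr1.
  by under eq_bigr do rewrite mulrC.
(* a mistake of the quantized pair, at scale [2 * eps], is one of the original pair
   at scale [eps], since the cells have radius [eps / 2] *)
have mistakes_ge : - (lam * (s * n%:R)) <=
    \sum_i \sum_j joint_law xi eta a b i j * v i j.
  pose c (w : Om) := (a (xi w), b (eta w)).
  have mc : coloring c.
    move=> [i j]; have -> : c @^-1` [set (i, j)] =
        xi @^-1` (a @^-1` [set i]) `&` eta @^-1` (b @^-1` [set j]).
      by apply/seteqP; split => w; rewrite /c/=; [case=> <- <-|case=> -> ->].
    exact: measurableI.
  have few : \sum_i \sum_j joint_law xi eta a b i j * (mistakes n (za i) (y_ j))%:R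
      <= s * n%:R.
    rewrite -lee_fin; apply: le_trans (ltW distE).
    apply: (@le_trans _ _ (\int[P]_w ((mistakes n (za (c w).1) (y_ (c w).2))%:R)%:E)%E).
      rewrite (@integral_comp_coloring _ _ _ P _ c
        (fun ij => (mistakes n (za ij.1) (y_ ij.2))%:R))//.
      rewrite lee_fin pair_bigA/=; apply: ler_sum => -[i j] _ /=.
      rewrite mulrC ler_wpM2l//; apply: fine_le; rewrite ?fin_num_measure//.
        exact: measurableI.
      apply: le_measure; rewrite ?inE//; first exact: measurableI.
      by move=> w [/= <- <-].
    apply: ge0_le_integral_nonmeasurable => w; rewrite lee_fin// ler_nat.
    apply: subset_leq_card; apply/fintype.subsetP => k; rewrite !inE => far.
    rewrite leNgt; apply/negP => near_k.
    have [/(_ k) near_xi _] := near_a (xi w).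
    have near_y := near_cc (tnth (eta w) k).
    move: far; rewrite y_E /b ffunE leNgt => /negP; apply.
    rewrite (le_lt_trans (metric_triangle _ (iter k T (xi w)) _))//.
    rewrite (metric_sym (iter k T (za _))) /=.
    have := metric_triangle (iter k T (xi w)) (tnth (eta w) k) (zc (cc (tnth (eta w) k))).
    lra.
  apply: (@le_trans _ _ (\sum_i \sum_j joint_law xi eta a b i j *
      - (lam * (mistakes n (za i) (y_ j))%:R))); last first.
    apply: ler_sum => i _; apply: ler_sum => j _; rewrite ler_wpM2l//.
    exact: joint_law_ge0.
  under eq_bigr do under eq_bigr do rewrite mulrN mulrCA.
  under eq_bigr do rewrite sumrN -mulr_sumr.
  by rewrite sumrN -mulr_sumr lerN2 ler_wpM2l.
have lengthE : \sum_i (\sum_j joint_law xi eta a b i j) *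
      ln (\sum_j (\sum_i' joint_law xi eta a b i' j) * expR (v i j)) =
    - \sum_i fine (mu (a @^-1` [set i])) * f (za i).
  rewrite -sumrN; apply: eq_bigr => i _; rewrite pE -mulrN; congr (_ * _).
  rewrite /f /code_length opprK likE; congr ln; apply: eq_bigr => j _.
  rewrite qE lnK// posrE.
  have /andP[+ _] := word_likelihood_bounds T kappa_ge kappa_le1 n (y_ j) (za i).
  by apply: lt_le_trans; exact: expR_gt0.
apply: le_trans (leeD2r e%:E (gibbs_mutual_information xi eta ma mb v)).
by rewrite -EFinD lee_fin lengthE; lra.
Qed.

Lemma rate_distortion_ge (mu : probability (borel X) R) (h : R) :
  (forall n cb, (0 < n)%N -> is_codebook cb ->
     h * n%:R <= expected_value mu (code_length T kappa n cb)) ->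
  (h%:E <= rate_distortion T mu eps)%E.
Proof.
move=> hcode; rewrite rate_distortion_sup.
have rate_ge s : 0 < s -> ((h - lam * s)%:E <= rate_distortion_at T mu eps s)%E.
  move=> s0; apply: le_ereal_inf_tmp => _ [n [d [Om [P [xi [eta [n0 adm ->]]]]]]].
  rewrite lee_fin_div ?ltr0n//; apply: mutual_information_ge adm => // cb.
  exact: hcode.
(* the mistakes cost at most [lam * s], which tends to [0] with [s] *)
apply/lee_addgt0Pr => e e0; pose s := e / (lam + 1).
have l0 : 0 < lam + 1 by rewrite ltr_wpDl.
have s0 : 0 < s by rewrite divr_gt0.
have se : lam * s <= e.
  by rewrite /s mulrCA ler_piMr ?ler_pdivrMr ?mul1r ?lerDl// ltW.
apply: (@le_trans _ _ (rate_distortion_at T mu eps s + e%:E)%E).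
  apply: le_trans (leeD2r e%:E (rate_ge s s0)).
  by rewrite -EFinD lee_fin; lra.
by apply: leeD2r; apply: ereal_sup_ubound; exists s.
Qed.

End RateLowerBound.

(** * Comparison of scales *)

Section KeyInequality.
Context {R : realType} {X : pmetricType R}.
Variable T : X -> X.
Hypothesis compactX : compact [set: X].
Hypothesis contT : continuous T.

(** With [M] cells of diameter less than [6 * eps], [lam] is chosen to be [ln M]: a
    mistake costs a factor [M] in likelihood, which makes up for the [M] cells in
    which it may occur, so that the likelihoods of a separated set sum to at most
    [2 ^ n].  This is the origin of [ln 2].  Between [2 * eps], below which the
    distortion at scale [eps] is absorbed, and [3 * eps], half the separation,
    [kappa] interpolates continuously. *)
Lemma spanning_rate_le_rate_distortion (eps : R) : 0 < eps ->
  (spanning_rate T (2 * (3 * eps)) <=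
   ereal_sup [set rate_distortion T mu eps | mu in ergodic_measures T]
     + (ln 2)%:E)%E.
Proof.
move=> eps0; set S := ereal_sup _.
have eps3 : 0 < 3 * eps by rewrite mulr_gt0.
have [||M [z [cell [_ near_z]]]] := @compact_open_coloring _ X
  (fun z => [set x | mdist x z < 3 * eps]) compactX.
- move=> z; apply: (@open_comp _ _ (fun x => mdist x z) [set t | t < 3 * eps]).
    by move=> x _; exact: continuous_mdistl.
  exact: open_lt.
- by move=> x; rewrite /= mdistxx.
have cell_small x x' : cell x = cell x' -> mdist x x' < 2 * (3 * eps).
  move=> cxx'; have := near_z x; have := near_z x'; rewrite /= cxx' metric_sym => h1 h2.
  rewrite (le_lt_trans (metric_triangle _ (z (cell x')) _))//.
  by rewrite mulr2n mulrDl mul1r ltrD.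
have M0 : (0 < M)%N by exact: leq_ltn_trans (leq0n _) (ltn_ord (cell point)).
pose lam : R := ln M%:R.
have lam0 : 0 <= lam by rewrite ln_ge0// ler1n.
have M_lam : M%:R * expR (- lam) <= 1.
  by rewrite expRN lnK ?posrE ?ltr0n// divff// pnatr_eq0 -lt0n.
pose kappa (x x' : X) : R := expR (- (lam * slice 2 (mdist x x' / eps))).
have kappa_ge x x' : expR (- lam) <= kappa x x'.
  by rewrite ler_expR lerN2 ler_piMr// slice_le1.
have kappa_le1 x x' : kappa x x' <= 1.
  by rewrite -[leRHS]expR0 ler_expR oppr_le0 mulr_ge0// slice_ge0.
have kappa_near x x' : mdist x x' < 2 * eps -> kappa x x' = 1.
  move=> xx'; rewrite /kappa slice_eq0 ?mulr0 ?oppr0 ?expR0//.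
  by rewrite ler_pdivrMr// ltW.
have kappa_far x x' : 3 * eps <= mdist x x' -> kappa x x' <= expR (- lam).
  by move=> xx'; rewrite /kappa slice_eq1 ?mulr1// ler_pdivlMr.
have kappa_continuous x' : continuous (fun x => kappa x x').
  move=> x; apply: (@continuous_comp _ _ _
    (fun x => - (lam * slice 2 (mdist x x' / eps))) (@expR R)); last first.
    exact: continuous_expR.
  apply: (@continuousN _ _ _ (fun x => lam * slice 2 (mdist x x' / eps))).
  apply: continuous_scalef; apply: continuous_slice => {}x.
  apply: cvgM; last exact: cvg_cst.
  exact: continuous_mdistl.
have reach (h : R) : (forall N s, (0 < N)%N -> is_codebook s ->
    exists2 L, invariant_state T L & h <= code_rate T kappa L N s) -> (h%:E <= S)%E.
  move=> /(ergodic_long_codes compactX contT kappa_continuous kappa_ge kappa_le1).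
  move=> [mu erg hmu]; apply: (@le_trans _ _ (rate_distortion T mu eps)).
    by apply: (@rate_distortion_ge _ _ T kappa lam).
  by apply: ereal_sup_ubound; exists mu.
have code_continuous N s : is_codebook s -> continuous (code_length T kappa N s).
  by apply: (@continuous_code_length _ _ _ _ lam).
have S0 : (0 <= S)%E.
  apply: reach => N s N0 cs.
  have [n|L KL L0] := empirical_limit compactX contT (c := 0) (code_continuous N s cs).
    exists n.+1, point; split => //; rewrite mul0r; apply: sumr_ge0 => i _.
    by have /andP[] := code_length_bounds T kappa_ge kappa_le1 N (iter i T point) cs.
  by exists L => //; rewrite divr_ge0.
have [->|Soo] := eqVneq S +oo%E; first by rewrite addye// leey.
have Sfin : S \is a fin_num by rewrite ge0_fin_numE// lt_neqAle Soo leey.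
rewrite -(fineK Sfin) -EFinD; apply/lee_addgt0Pr => e e0.
rewrite leNgt; apply/negP; rewrite -EFinD addrAC => lt.
have h0 : 0 <= fine S + e by rewrite addr_ge0 ?fine_ge0// ltW.
suff : ((fine S + e)%:E <= S)%E.
  by rewrite -{2}(fineK Sfin) lee_fin gerDl leNgt e0.
apply: reach => N s N0 cs; apply: contrapT => no.
move: lt; rewrite ltNge => /negP; apply.
apply: (@spanning_rate_le _ _ T kappa lam compactX contT kappa_continuous kappa_ge
  kappa_le1 _ M cell cell_small kappa_far M_lam s N) => // L KL.
rewrite ltNge; apply/negP => le; apply: no; exists L => //.
by rewrite ler_pdivlMr ?ltr0n// mulrC.
Qed.

End KeyInequality.

Section Limits.
Context {R : realType}.
Implicit Types (f u v : R -> \bar R) (V : set R).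

Lemma at_right0P V : (0 : R)^'+ V <-> exists2 d, 0 < d & forall x, 0 < x < d -> V x.
Proof.
split=> [|[d d0 dV]].
  move=> /nbhs_ballP[d /= d0 dV]; exists d => // x /andP[x0 xd].
  by apply: dV => //; rewrite /ball/= sub0r normrN gtr0_norm.
near=> x; apply: dV; apply/andP; split.
  by near: x; exact: nbhs_right_gt.
by near: x; exact: nbhs_right_lt.
Unshelve. all: by end_near. Qed.

Lemma lee_of_lte_fin (x y : \bar R) :
  (forall a : R, (y < a%:E)%E -> (x <= a%:E)%E) -> (x <= y)%E.
Proof.
case: y => [y||] h; last 2 first.
- by rewrite leey.
- have xa (a : R) : (x <= a%:E)%E by apply: h; exact: ltNyr.
  case: x {h} xa => [x| |] // xa.
    by have := xa ((x : R) - 1)%R; rewrite lee_fin lerBrDr gerDl ler10.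
  by have := xa 0; rewrite leye_eq.
- apply/lee_addgt0Pr => e e0; rewrite -EFinD; apply: h.
  by rewrite lte_fin ltrDl.
Qed.

Lemma limf_esup_lt f (a : R) : (limf_esup f (0 : R)^'+ < a%:E)%E ->
  exists2 d, 0 < d & forall x, 0 < x < d -> (f x <= a%:E)%E.
Proof.
rewrite limf_esupE => /ereal_inf_lt[_ [V /at_right0P[d d0 dV] <-]] /ltW le.
exists d => // x xd; apply: le_trans le; apply: ereal_sup_ubound.
by exists x => //; exact: dV.
Qed.

Lemma limf_esup_le f (a : R) d : 0 < d ->
  (forall x, 0 < x < d -> (f x <= a%:E)%E) -> (limf_esup f (0 : R)^'+ <= a%:E)%E.
Proof.
move=> d0 fa; rewrite limf_esupE.
pose V := [set x : R | 0 < x < d].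
apply: (@le_trans _ _ (ereal_sup [set f x | x in V])).
  by apply: ereal_inf_lbound; exists V => //; apply/at_right0P; exists d.
by apply: ge_ereal_sup => _ [x /= xd <-]; exact: fa.
Qed.

Lemma limf_einf_lt f (a d : R) : (limf_einf f (0 : R)^'+ < a%:E)%E -> 0 < d ->
  exists x, 0 < x < d /\ (f x <= a%:E)%E.
Proof.
move=> lt d0; apply: contrapT => /forallNP no.
move: lt; rewrite ltNge => /negP; apply.
rewrite /limf_einf leeNr -EFinN; apply: (limf_esup_le d0) => x xd.
rewrite EFinN leeN2 leNgt; apply/negP => /ltW fx.
by apply: (no x).
Qed.

Lemma limf_einf_le f (a : R) :
  (forall d, 0 < d -> exists x, 0 < x < d /\ (f x <= a%:E)%E) ->
  (limf_einf f (0 : R)^'+ <= a%:E)%E.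
Proof.
move=> fa; rewrite /limf_einf leeNl -EFinN limf_esupE.
apply: le_ereal_inf_tmp => _ [V /at_right0P[d d0 dV] <-].
have [x [xd fx]] := fa d d0.
apply: (@le_trans _ _ (- f x)%E); first by rewrite EFinN leeN2.
by apply: ereal_sup_ubound; exists x => //; exact: dV.
Qed.

(** After division by [ln eps^-1], neither a bounded change of scale nor a bounded
    additive term matters. *)
Lemma limf_scale_le u v (c K : R) : 0 < c ->
  (forall e : R, 0 < e -> (u (c * e)%R <= v e + K%:E)%E) ->
  (limf_esup (fun e : R => u e / (ln e^-1)%:E)%E (0 : R)^'+ <=
   limf_esup (fun e : R => v e / (ln e^-1)%:E)%E (0 : R)^'+)%E /\
  (limf_einf (fun e : R => u e / (ln e^-1)%:E)%E (0 : R)^'+ <=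
   limf_einf (fun e : R => v e / (ln e^-1)%:E)%E (0 : R)^'+)%E.
Proof.
move=> c0 uv.
have transfer (a e : R) : 0 < e -> exists2 d, 0 < d & forall x, 0 < x < d ->
    (v x / (ln x^-1)%:E <= a%:E)%E ->
    (u (c * x)%R / (ln (c * x)^-1)%:E <= (a + e)%:E)%E.
  move=> e0.
  pose m := Num.max 1 ((a * ln c + K) / e).
  exists (Num.min 1 (expR (- m) / c)).
    by rewrite lt_min ltr01/= divr_gt0// expR_gt0.
  move=> x /andP[x0]; rewrite lt_min => /andP[x1 xm].
  have lx : 0 < ln x^-1 by rewrite lnV ?posrE// oppr_gt0 ln_lt0// x0.
  have cx0 : 0 < c * x by rewrite mulr_gt0.
  have ml : m <= ln (c * x)^-1.
    rewrite lnV ?posrE// lerNr -[leRHS]expRK ler_ln ?posrE ?expR_gt0//.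
    by rewrite mulrC -ler_pdivlMr// ltW.
  have m1 : 1 <= m by rewrite le_max lexx.
  have m2 : (a * ln c + K) / e <= m by rewrite le_max lexx orbT.
  have lcx : 0 < ln (c * x)^-1 by apply: lt_le_trans ml; lra.
  rewrite !lee_div_fin// => va; apply: (le_trans (uv x x0)).
  apply: (le_trans (leeD2r K%:E va)); rewrite -EFinD lee_fin.
  have lE : ln x^-1 = ln (c * x)^-1 + ln c.
    by rewrite !lnV ?posrE// lnM ?posrE//; lra.
  have : a * ln c + K <= e * ln (c * x)^-1.
    by rewrite [leRHS]mulrC -ler_pdivrMr// (le_trans m2).
  by rewrite lE mulrDr mulrDl; lra.
split; apply: lee_of_lte_fin => a lt; apply/lee_addgt0Pr => e e0; rewrite -EFinD;
  have [d d0 dP] := transfer a e e0.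
- have [d' d'0 va] := limf_esup_lt lt.
  apply: (@limf_esup_le _ _ (c * Num.min d d')).
    by rewrite mulr_gt0// lt_min d0.
  move=> x /andP[x0 xd]; have -> : x = c * (x / c) by rewrite mulrC divfK// gt_eqF.
  have : x / c < Num.min d d' by rewrite ltr_pdivrMr// mulrC.
  rewrite lt_min => /andP[xd1 xd2].
  by apply: dP; [|apply: va]; rewrite divr_gt0.
- apply: limf_einf_le => r r0.
  have [|x [/andP[x0]]] := limf_einf_lt (d := Num.min d (r / c)) lt.
    by rewrite lt_min d0 divr_gt0.
  rewrite lt_min => /andP[xd xr] va; exists (c * x); split.
    by rewrite mulr_gt0//= mulrC -ltr_pdivlMr.
  by apply: dP => //; rewrite x0.
Qed.

End Limits.

Theorem theorem1p1 (R : realType) (X : pmetricType R) (T : X -> X)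
    (compactX : compact [set: X]) (contT : continuous T) :
  upper_mdim T =
    limf_esup (fun eps : R =>
      ereal_sup [set rate_distortion T mu eps | mu in ergodic_measures T]
        / (ln eps^-1)%:E)%E 0^'+
  /\
  lower_mdim T =
    limf_einf (fun eps : R =>
      ereal_sup [set rate_distortion T mu eps | mu in ergodic_measures T]
        / (ln eps^-1)%:E)%E 0^'+.
Proof.
pose u (e : R) : \bar R := spanning_rate T e.
pose v (e : R) : \bar R :=
  ereal_sup [set rate_distortion T mu e | mu in ergodic_measures T].
have [||uv_sup uv_inf] := @limf_scale_le R u v 6 (ln 2).
- by [].
- move=> e e0; have -> : 6 * e = 2 * (3 * e) by lra.
  exact: spanning_rate_le_rate_distortion.
have [|vu_sup vu_inf] := @limf_scale_le R v u 1 0 ltr01.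
- move=> e e0; rewrite mul1r adde0; apply: ge_ereal_sup => _ [mu _ <-].
  exact: rate_distortion_le_spanning_rate.
by split; apply/eqP; rewrite eq_le ?uv_sup ?uv_inf ?vu_sup ?vu_inf.
Qed.
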